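(* Let $(V,Y,\mathbf 1)$ be a vertex algebra over $\mathbb C$, let $0\neq p(x)\in\mathbb C((x))$ and $\phi(x,z)=e^{zp(x)\frac{d}{dx}}(x)$, and let $(W,Y_W)$ be a $\phi$-coordinated $V$-module. Then for $u,v\in V$, $$[Y_W(u,z_1),Y_W(v,z_2)]=\sum_{j\ge 0}Y_W(u_jv,z_2)\,\frac{1}{j!}\left(p(z_2)\frac{\partial}{\partial z_2}\right)^{j}\left(\bar p(z_1)\,\delta\!\left(\frac{z_2}{z_1}\right)\right),$$ where $\bar p(x)=x^{-1}p(x)$. Conversely, if $W$ is faithful and $$[Y_W(u,z_1),Y_W(v,z_2)]=\sum_{j\ge 0}Y_W(c_j,z_2)\,\frac{1}{j!}\left(p(z_2)\frac{\partial}{\partial z_2}\right)^{j}\left(\bar p(z_1)\,\delta\!\left(\frac{z_2}{z_1}\right)\right)$$ for some $c_j\in V$, then $c_j=u_jv$ for all $j\ge 0$.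
   Context: For $u,v\in V$ write $Y(u,z)v=\sum_{n\in\mathbb Z}u_nv\,z^{-n-1}$. Here $\phi(x,z)=\sum_{n\ge0}\frac{z^n}{n!}\left(p(x)\frac{d}{dx}\right)^n(x)\in\mathbb C((x))[[z]]$, and $\delta(z)=\sum_{n\in\mathbb Z}z^n$. $W((z_1,z_2))$ denotes $W[[z_1,z_2]][z_1^{-1},z_2^{-1}]$. For $A(z_1,z_2)\in\mathrm{Hom}(W,W((z_1,z_2)))$, the substitution $A(z_1,z_2)|_{z_1=\phi(z_2,z_0)}$ is the element $\left(e^{z_0p(z_1)\partial/\partial z_1}A(z_1,z_2)\right)|_{z_1=z_2}$ of $\mathrm{Hom}(W,W((z_2)))[[z_0]]$. A $\phi$-coordinated $V$-module is a vector space $W$ with a linear map $Y_W(\cdot,z):V\to\mathrm{Hom}(W,W((z)))\subset(\mathrm{End}\,W)[[z,z^{-1}]]$ such that $Y_W(\mathbf 1,z)=1_W$ and for all $u,v\in V$ there is a nonnegative integer $k$ with $(z_1-z_2)^kY_W(u,z_1)Y_W(v,z_2)\in\mathrm{Hom}(W,W((z_1,z_2)))$ and $(\phi(z_2,z_0)-z_2)^kY_W(Y(u,z_0)v,z_2)=\left((z_1-z_2)^kY_W(u,z_1)Y_W(v,z_2)\right)|_{z_1=\phi(z_2,z_0)}$. $W$ is faithful if the map $v\mapsto Y_W(v,z)$ is injective. *)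

(* Defs.v *)
From HB Require Import structures.
From mathcomp Require Import all_boot all_order all_algebra.
From mathcomp Require Import complex.
From mathcomp Require Import all_classical all_reals.

Set Implicit Arguments.
Unset Strict Implicit.
Unset Printing Implicit Defensive.

Import GRing.Theory.
Local Open Scope ring_scope.

(* A formal series in M[[z, z^-1]] is its coefficient function [int -> M],
   [f n] being the coefficient of z^n.  A series in two variables is curried:
   [f m n] is the coefficient of x^m y^n, where x is the first variable.
   A sum over an infinite index set is [\sum_(i \in setT) F i] from fsbigop,
   which has the intended value because every summand family below has finite
   support whenever it is used on series for which the operation is defined. *)

Definition is_laurent (M : nmodType) (f : int -> M) : Prop :=
  exists N : int, forall n : int, n < N -> f n = 0.

Definition const_series (M : nmodType) (v : M) : int -> M :=
  fun n => if n == 0 then v else 0.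

Definition conv (A B M : nmodType) (op : A -> B -> M)
    (f : int -> A) (g : int -> B) : int -> M :=
  fun n => \sum_(i \in [set: int]) op (f i) (g (n - i)).

Section FormalCalculus.
Variable K : fieldType.

Definition smul (M : lmodType K) (p : int -> K) (f : int -> M) : int -> M :=
  conv (fun (a : K) (m : M) => a *: m) p f.

(* The action of K((y))((x)) on M((y))((x)). *)
Definition smul2 (M : lmodType K) (A : int -> int -> K) (F : int -> int -> M) :
    int -> int -> M :=
  conv (@smul M) A F.

Definition fderiv (M : lmodType K) (f : int -> M) : int -> M :=
  fun n => (n + 1)%:~R *: f (n + 1).

Definition pD (M : lmodType K) (p : int -> K) (f : int -> M) : int -> M :=
  smul p (fderiv f).

Definition pDdiv (M : lmodType K) (p : int -> K) (j : nat) (f : int -> M) :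
    int -> M :=
  fun n => (j`!%:R : K)^-1 *: iter j (pD p) f n.

(* e^{z p(x) d/dx} f(x); the first index is the exponent of z. *)
Definition exp_pD (M : lmodType K) (p : int -> K) (f : int -> M) :
    int -> int -> M :=
  fun m => match m with Posz j => pDdiv p j f | Negz _ => fun=> 0 end.

Definition varx : int -> K := fun n => (n == 1)%:R.

(* phi(x, z), with the exponent of z as the first index. *)
Definition phi (p : int -> K) : int -> int -> K :=
  exp_pD p (varx : int -> K^o).

Definition phi_sub (p : int -> K) : int -> int -> K :=
  fun m n => phi p m n - const_series varx m n.

Definition mul_z1z2 (M : lmodType K) (A : int -> int -> M) : int -> int -> M :=
  fun a b => A (a - 1) b - A a (b - 1).

(* Membership in M((z_1, z_2)) = M[[z_1, z_2]][z_1^-1, z_2^-1]. *)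
Definition is_laurent2 (M : nmodType) (A : int -> int -> M) : Prop :=
  exists N : int, forall a b : int, (a < N) || (b < N) -> A a b = 0.

Definition diag (M : nmodType) (A : int -> int -> M) : int -> M :=
  fun n => \sum_(a \in [set: int]) A a (n - a).

(* A(z_1, z_2)|_{z_1 = phi(z_2, z_0)}: the operator p(z_1) d/dz_1 acts on A as
   a series in z_1 with coefficients in M[[z_2, z_2^-1]].  In the result the
   first index is the exponent of z_0, the second that of z_2. *)
Definition subst_phi (M : lmodType K) (p : int -> K) (A : int -> int -> M) :
    int -> int -> M :=
  fun m => diag (exp_pD p (A : int -> (int -> M)) m).

Definition gbinom (m : int) (i : nat) : K :=
  (\prod_(0 <= k < i) (m - k%:Z)%:~R) / i`!%:R.

(* u_n v, where Y u v is the series Y(u, z)v, i.e. Y u v m is the coefficient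
   of z^m and Y(u, z)v = \sum_n u_n v z^{-n-1}. *)
Definition mode (V : lmodType K) (Y : V -> V -> int -> V)
    (u : V) (n : int) (v : V) : V := Y u v (- n - 1).

(* The Jacobi identity is written as the equality of the coefficients of
   z_0^{-l-1} z_1^{-m-1} z_2^{-n-1} (Borcherds identity). *)
Record is_vertex_algebra (V : lmodType K) (Y : V -> V -> int -> V) (vac : V) :
    Prop := {
  va_linear_l : forall (v : V) (n : int), linear (fun u => Y u v n);
  va_linear_r : forall (u : V) (n : int), linear (fun v => Y u v n);
  va_truncation : forall u v : V, is_laurent (Y u v);
  va_vacuum : forall v : V, Y vac v = const_series v;
  va_creation : forall v : V,
    Y v vac 0 = v /\ forall n : int, n < 0 -> Y v vac n = 0;
  va_jacobi : forall (u v w : V) (l m n : int),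
    \sum_(i \in [set: nat])
       gbinom m i *: mode Y (mode Y u (l + i%:Z) v) (m + n - i%:Z) w =
    \sum_(i \in [set: nat])
       ((-1) ^+ i * gbinom l i) *:
         (mode Y u (m + l - i%:Z) (mode Y v (n + i%:Z) w)
          - (-1) ^ l *: mode Y v (n + l - i%:Z) (mode Y u (m + i%:Z) w))
}.

Definition prod_z1z2 (V W : lmodType K) (YW : V -> W -> int -> W)
    (u v : V) (w : W) : int -> int -> W :=
  fun a b => YW u (YW v w b) a.

(* phi-coordinated V-module; YW v w is the series Y_W(v, z)w. *)
Record is_phi_module (V : lmodType K) (Y : V -> V -> int -> V) (vac : V)
    (p : int -> K) (W : lmodType K) (YW : V -> W -> int -> W) : Prop := {
  pm_linear_l : forall (w : W) (n : int), linear (fun v => YW v w n);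
  pm_linear_r : forall (v : V) (n : int), linear (fun w => YW v w n);
  pm_truncation : forall (v : V) (w : W), is_laurent (YW v w);
  pm_vacuum : forall w : W, YW vac w = const_series w;
  pm_assoc : forall u v : V, exists k : nat,
    (forall w : W, is_laurent2 (iter k (@mul_z1z2 W) (prod_z1z2 YW u v w))) /\
    (forall w : W,
       iter k (smul2 (phi_sub p)) (fun m => YW (Y u v m) w) =
       subst_phi p (iter k (@mul_z1z2 W) (prod_z1z2 YW u v w)))
}.

Definition is_faithful (V W : lmodType K) (YW : V -> W -> int -> W) : Prop :=
  injective YW.

Definition commutator (V W : lmodType K) (YW : V -> W -> int -> W)
    (u v : V) (w : W) : int -> int -> W :=
  fun a b => prod_z1z2 YW u v w a b - prod_z1z2 YW v u w b a.

(* delta(z_2 / z_1) = \sum_n z_2^n z_1^-n *)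
Definition delta21 : int -> int -> K := fun a b => (a + b == 0)%:R.

(* pbar(z_1) delta(z_2 / z_1), with pbar(x) = x^-1 p(x).  The product is taken
   for each power z_2^b separately: as a series in z_1 over K[[z_2, z_2^-1]]
   the sum would not have finite support. *)
Definition pbar_delta (p : int -> K) : int -> int -> K :=
  fun a b => conv *%R (fun n => p (n + 1)) (fun a' => delta21 a' b) a.

(* Y_W(c, z_2) (1/j!) (p(z_2) d/dz_2)^j (pbar(z_1) delta(z_2/z_1)) w; each
   coefficient of a power of z_1 is a series in z_2 in W((z_2)). *)
Definition comm_term (V W : lmodType K) (p : int -> K)
    (YW : V -> W -> int -> W) (c : V) (j : nat) (w : W) : int -> int -> W :=
  fun a => smul (pDdiv p j (pbar_delta p a : int -> K^o)) (YW c w).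

(* \sum_(j >= 0) f_j = g in the z-adic topology of M((z)): modulo every
   z^N M[[z]] the partial sums are eventually equal to g.  If f_j = 0 for
   large j, this says that the finite sum of the f_j is g. *)
Definition laurent_sum (M : nmodType) (f : nat -> int -> M) (g : int -> M) :
    Prop :=
  forall N : int, exists J : nat, forall J' : nat, (J <= J')%N ->
    forall n : int, n < N -> \sum_(0 <= j < J') f j n = g n.

(* [Y_W(u, z_1), Y_W(v, z_2)]
     = \sum_(j >= 0) Y_W(c_j, z_2) (1/j!) (p(z_2) d/dz_2)^j
                       (pbar(z_1) delta(z_2/z_1)),
   applied to each w and read off at each power z_1^a. *)
Definition commutator_formula (V W : lmodType K) (p : int -> K)
    (YW : V -> W -> int -> W) (u v : V) (c : nat -> V) : Prop :=
  forall (w : W) (a : int),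
    laurent_sum (fun j => comm_term p YW (c j) j w a) (commutator YW u v w a).

End FormalCalculus.

(* Main.v *)
Require Import Defs.
From HB Require Import structures.
From mathcomp Require Import all_boot all_order all_algebra.
From mathcomp Require Import complex.
From mathcomp Require Import all_classical all_reals.
From mathcomp Require Import zify ring.
(** Put D = p(x) d/dx, phi = e^{z0 D} x and y = phi - x. For fixed u, v, w write
    E(z0) = Y_W(Y(u, z0) v, x) w, and for k large let A in W((z1, z2)) be
    (z1 - z2)^k Y_W(u, z1) Y_W(v, z2) w. The module axiom says
    y^k E = A(phi(x, z0), x).

    Commutativity up to a power of z1 - z2. The axiom for the pair (u, vac) gives
    Y_W(e^{z0 T} u, x) = e^{z0 D} Y_W(u, x), T being the translation operator, so
    skew-symmetry of V relates E to the analogous series for (v, u)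
    ([product_series_skew]). In terms of substitutions this exchanges phi and x,
    hence A(phi, x) = (-1)^k B(x, phi) with B the series A for (v, u). Since p is
    nonzero, the substitution is injective ([tau_inj]), whence
    A(z1, z2) = (-1)^k B(z2, z1) ([weak_commutativity]).

    The formula. The two products of fields are now the two expansions of
    (z1 - z2)^{-k} A, and E = y^{-k} A(phi, x). Dividing A repeatedly by z1 - z2
    with remainder, one compares both sides on (z1 - z2)^{-k} h(z2): the residue
    in z1 of the difference of expansions equals the residue in z0 after
    z1 = phi(x, z0), because y^{-k} (d phi / d z0) has residue 1 for k = 1 and is
    exact otherwise ([diff_residue]). So the coefficient of the commutator at
    z1^a is Res_{z0} E phi^{-a-1} p(phi), which is the right-hand side since
    phi^{-a-1} p(phi) = e^{z0 D}(p(x) x^{-a-1}).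

    Uniqueness. The difference of two such formulas is an operator
    sum_j f_j D^j / j! with f_j in W((x)), possibly of infinite order, which kills
    p(x) x^m for all m. Looking at leading terms in x, where D^j acts on x^n by a
    polynomial in n of degree j, all f_j vanish ([formal_operator_unique]);
    faithfulness then identifies the vectors.

    All series live in the rings R((x)) and R((x))((z)), where R is the square-zero
    extension of the field by W; there module-valued and scalar series multiply,
    and y is invertible. *)

Set Implicit Arguments.
Unset Strict Implicit.
Unset Printing Implicit Defensive.
Import Order.TTheory GRing.Theory Num.Theory.
Local Open Scope ring_scope.

(** * Sums over the integers with finite support *)

Definition isum (M : nmodType) (F : int -> M) : M := \sum_(i \in [set: int]) F i.

(** Products of Laurent series have summands supported in a half-open interval;
    an explicit interval makes every exchange of sums a finite one. *)
Definition isupp (M : nmodType) (a b : int) (F : int -> M) : Prop :=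
  forall i, ~~ (a <= i < b) -> F i = 0.

Definition irange (a b : int) : seq int :=
  [seq a + k%:Z | k <- iota 0 `|Num.max 0 (b - a)|].

Lemma mem_irange a b i : (i \in irange a b) = (a <= i < b).
Proof.
apply/mapP/idP => [[k]|ab]; first by rewrite mem_iota => ? ->; lia.
by exists `|i - a|%N; [rewrite mem_iota; lia|lia].
Qed.

Lemma irange_uniq a b : uniq (irange a b).
Proof. by rewrite map_inj_uniq ?iota_uniq// => k l; lia. Qed.

Lemma fsum_seq (M : nmodType) (I : choiceType) (s : seq I) (F : I -> M) :
    uniq s -> (forall i, i \notin s -> F i = 0) ->
  \sum_(i \in [set: I]) F i = \sum_(i <- s) F i.
Proof.
move=> us Fs; rewrite [RHS]fsbig_seq//; apply/esym; apply: fsbig_widen => //.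
by move=> i /= [_] /negP /Fs.
Qed.

Section IntegerSums.
Variable M : nmodType.
Implicit Types F G : int -> M.

Lemma isum_seq (s : seq int) F : uniq s -> (forall i, i \notin s -> F i = 0) ->
  isum F = \sum_(i <- s) F i.
Proof. exact: fsum_seq. Qed.

Lemma isumE a b F : isupp a b F -> isum F = \sum_(i <- irange a b) F i.
Proof.
move=> Fab; apply: isum_seq (irange_uniq a b) _ => i.
by rewrite mem_irange; exact: Fab.
Qed.

Lemma eq_isum F G : F =1 G -> isum F = isum G.
Proof. by move=> /funext ->. Qed.

Lemma isum1 k F : (forall i, i != k -> F i = 0) -> isum F = F k.
Proof.
move=> Fk; rewrite (@isum_seq [:: k]) ?big_seq1// => i.
by rewrite inE; exact: Fk.
Qed.

Lemma isum0 F : (forall i, F i = 0) -> isum F = 0.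
Proof. by move=> F0; rewrite (@isum1 0). Qed.

Lemma isum_add a b F G : isupp a b F -> isupp a b G ->
  isum (fun i => F i + G i) = isum F + isum G.
Proof.
move=> Fab Gab; rewrite !(@isumE a b)// ?big_split// => i iab.
by rewrite Fab// Gab// addr0.
Qed.

Lemma isum_exchange a b c d (F : int -> int -> M) :
  (forall i j, ~~ (a <= i < b) || ~~ (c <= j < d) -> F i j = 0) ->
  isum (fun i => isum (F i)) = isum (fun j => isum (F^~ j)).
Proof.
move=> Fs.
have E1 i : isum (F i) = \sum_(j <- irange c d) F i j.
  by apply: isumE => j jcd; apply: Fs; rewrite jcd orbT.
have E2 j : isum (F^~ j) = \sum_(i <- irange a b) F i j.
  by apply: isumE => i iab; apply: Fs; rewrite iab.
rewrite (eq_isum E1) (eq_isum E2) (@isumE a b); last first.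
  by move=> i iab; apply: big1 => j _; apply: Fs; rewrite iab.
rewrite [RHS](@isumE c d); first exact: exchange_big.
by move=> j jcd; apply: big1 => i _; apply: Fs; rewrite jcd orbT.
Qed.

Lemma isum_reindex (h g : int -> int) F : cancel h g -> cancel g h ->
  isum (fun i => F (h i)) = isum F.
Proof.
move=> hK gK; rewrite /isum [RHS](@reindex_fsbig _ _ _ _ _ h setT)//.
by rewrite setTT_bijective; exists g.
Qed.

Lemma isum_shift c F : isum (fun i => F (i + c)) = isum F.
Proof. by apply: (@isum_reindex _ (fun i => i - c)) => i; lia. Qed.

Lemma isum_rev c F : isum (fun i => F (c - i)) = isum F.
Proof. by apply: (@isum_reindex _ (fun i => c - i)) => i; lia. Qed.

End IntegerSums.

Lemma isum_morph (M N : nmodType) (h : M -> N) a b F :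
  h 0 = 0 -> {morph h : x y / x + y} -> isupp a b F ->
  h (isum F) = isum (fun i => h (F i)).
Proof.
move=> h0 hD Fab; rewrite (isumE Fab) (@isumE _ a b).
  exact: (big_morph h hD h0).
by move=> i iab; rewrite Fab.
Qed.

Lemma isum_sub (M : zmodType) a b (F G : int -> M) : isupp a b F -> isupp a b G ->
  isum (fun i => F i - G i) = isum F - isum G.
Proof.
move=> Fab Gab; rewrite !(@isumE _ a b)// ?sumrB// => i iab.
by rewrite Fab// Gab// subr0.
Qed.

(** * The ring of formal Laurent series *)

Record laurent (M : nmodType) :=
  Laurent { lcoef :> int -> M; lcoefP : is_laurent lcoef }.

Definition order_ge (M : nmodType) (a : int) (f : int -> M) : Prop :=
  forall n, n < a -> f n = 0.

Lemma laurent_ext (M : nmodType) (f g : laurent M) : f =1 g -> f = g.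
Proof.
case: f g => [f fP] [g gP] /= /funext fg; rewrite -{g}fg in gP *.
by congr Laurent; exact: Prop_irrelevance.
Qed.

HB.instance Definition _ (M : nmodType) := gen_eqMixin (laurent M).
HB.instance Definition _ (M : nmodType) := gen_choiceMixin (laurent M).

Lemma order_geW (M : nmodType) a b (f : int -> M) : a <= b -> order_ge b f -> order_ge a f.
Proof. by move=> ab fb n na; apply: fb; lia. Qed.

Lemma order_ge_common (M : nmodType) (f g : laurent M) :
  exists N, [/\ N <= 0, order_ge N f & order_ge N g].
Proof.
have [[a fa] [b gb]] := (lcoefP f, lcoefP g).
exists (- (`|a| + `|b|)%N%:Z); split; first by lia.
  by apply: order_geW fa; lia.
by apply: order_geW gb; lia.
Qed.

Section LaurentZmodule.
Variable M : zmodType.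
Implicit Types f g : laurent M.

Fact lzero_subproof : is_laurent (fun=> 0 : M).
Proof. by exists 0. Qed.
Definition lzero := Laurent lzero_subproof.

Fact ladd_subproof f g : is_laurent (fun n => f n + g n).
Proof.
have [N [_ fN gN]] := order_ge_common f g.
by exists N => n nN; rewrite fN// gN// addr0.
Qed.
Definition ladd f g := Laurent (ladd_subproof f g).

Fact lopp_subproof f : is_laurent (fun n => - f n).
Proof. by have [N fN] := lcoefP f; exists N => n nN; rewrite fN// oppr0. Qed.
Definition lopp f := Laurent (lopp_subproof f).

Fact laddA : associative ladd.
Proof. by move=> f g h; apply: laurent_ext => n /=; rewrite addrA. Qed.
Fact laddC : commutative ladd.
Proof. by move=> f g; apply: laurent_ext => n /=; rewrite addrC. Qed.
Fact ladd0 : left_id lzero ladd.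
Proof. by move=> f; apply: laurent_ext => n /=; rewrite add0r. Qed.
Fact laddN : left_inverse lzero lopp ladd.
Proof. by move=> f; apply: laurent_ext => n /=; rewrite addNr. Qed.

HB.instance Definition _ :=
  GRing.isZmodule.Build (laurent M) laddA laddC ladd0 laddN.

Lemma coefl0 n : (0 : laurent M) n = 0. Proof. by []. Qed.
Lemma coeflD f g n : (f + g) n = f n + g n. Proof. by []. Qed.
Lemma coeflN f n : (- f) n = - f n. Proof. by []. Qed.
Lemma coeflB f g n : (f - g) n = f n - g n. Proof. by []. Qed.

Lemma coeflMn f k n : (f *+ k) n = f n *+ k.
Proof. by elim: k => // k IHk; rewrite !mulrS coeflD IHk. Qed.

Lemma coeflMz f k n : (f *~ k) n = f n *~ k.
Proof. by case: k => k; rewrite -?pmulrn ?NegzE ?mulrNz ?coeflN -?pmulrn coeflMn. Qed.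

Lemma coefl_isum a b (F : int -> laurent M) n : isupp a b F ->
  isum F n = isum (fun i => F i n).
Proof. exact: (@isum_morph _ _ (fun f : laurent M => f n)). Qed.

Fact mono_subproof (k : int) (c : M) : is_laurent (fun n => if n == k then c else 0).
Proof. by exists k => n; case: eqP => // ->; rewrite ltxx. Qed.
Definition mono k c := Laurent (mono_subproof k c).

Lemma monoD k : {morph mono k : c d / c + d}.
Proof. by move=> c d; apply: laurent_ext => n /=; case: ifP => // _; rewrite addr0. Qed.

Lemma monoN k c : mono k (- c) = - mono k c.
Proof. by apply: laurent_ext => n /=; case: ifP => // _; rewrite oppr0. Qed.

Lemma order_ge_mono k c : order_ge k (mono k c).
Proof. by move=> n nk /=; rewrite lt_eqF. Qed.

End LaurentZmodule.

(** Continuity: subtracting monomials one by one pushes the order of the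
    argument, hence that of its image, to infinity. *)
Lemma laurent_dense (M N : zmodType) (D : laurent M -> laurent N) (s : int) :
    (forall f g, D (f - g) = D f - D g) -> (forall k c, D (mono k c) = 0) ->
    (forall a (f : laurent M), order_ge a f -> order_ge (a + s) (D f)) ->
  forall f, D f = 0.
Proof.
move=> DB D0 Ds f; have [a fa] := lcoefP f.
have Dk (k : nat) : exists2 g : laurent M, order_ge (a + k%:Z) g & D f = D g.
  elim: k => [|k [g gk ->]]; first by exists f => //; rewrite addr0.
  exists (g - mono (a + k%:Z) (g (a + k%:Z))); last by rewrite DB D0 subr0.
  move=> n nk; rewrite coeflB /=; case: eqP => [->|?]; first by rewrite subrr.
  by rewrite gk ?subr0//; lia.
apply: laurent_ext => n; have [g ga ->] := Dk `|(n + 1 - a - s)%R|%N.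
by apply: (Ds _ _ ga); lia.
Qed.

Section LaurentRing.
Variable R : comNzRingType.
Implicit Types f g h : laurent R.

Lemma isupp_conv a b (f g : int -> R) n : order_ge a f -> order_ge b g ->
  isupp a (n - b + 1) (fun i => f i * g (n - i)).
Proof.
move=> fa gb i iab; have [ia|ai] := ltP i a; first by rewrite fa// mul0r.
by rewrite gb ?mulr0//; lia.
Qed.

Arguments isupp_conv {a b f g} n fa gb : rename.

Lemma order_ge_conv a b (f g : int -> R) : order_ge a f -> order_ge b g ->
  order_ge (a + b) (conv *%R f g).
Proof.
move=> fa gb n nab; apply: isum0 => i.
have [ia|ai] := ltP i a; first by rewrite fa// mul0r.
by rewrite gb ?mulr0//; lia.
Qed.

Fact lmul_subproof f g : is_laurent (conv *%R f g).
Proof.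
by have [[a fa] [b gb]] := (lcoefP f, lcoefP g); exists (a + b); exact: order_ge_conv.
Qed.
Definition lmul f g := Laurent (lmul_subproof f g).

Fact lmulC : commutative lmul.
Proof.
move=> f g; apply: laurent_ext => n; rewrite -[LHS](isum_rev n).
by apply: eq_isum => i; rewrite mulrC; congr (g _ * f _); lia.
Qed.

Lemma isum_distrr a b (c : R) (F : int -> R) : isupp a b F ->
  c * isum F = isum (fun i => c * F i).
Proof. by apply: isum_morph; [rewrite mulr0 | exact: mulrDr]. Qed.

Lemma isum_distrl a b (c : R) (F : int -> R) : isupp a b F ->
  isum F * c = isum (fun i => F i * c).
Proof.
by apply: (@isum_morph _ _ (fun x => x * c)); [rewrite mul0r | move=> ? ?; rewrite mulrDl].
Qed.

Fact lmulA : associative lmul.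
Proof.
move=> f g h; apply: laurent_ext => n.
have [a fa] := lcoefP f; have [b gb] := lcoefP g; have [c hc] := lcoefP h.
transitivity (isum (fun i => isum (fun j => f i * (g (j - i) * h (n - j))))).
  apply: eq_isum => i; rewrite (isum_distrr _ (isupp_conv _ gb hc)).
  rewrite -[LHS](isum_shift (- i)).
  by apply: eq_isum => j; congr (_ * (_ * h _)); lia.
rewrite (@isum_exchange _ a (n - b - c + 1) (a + b) (n - c + 1)); last first.
  move=> i j ij; have [ia|ai] := ltP i a; first by rewrite fa// mul0r.
  have [jb|bj] := ltP (j - i) b; first by rewrite gb// mul0r mulr0.
  by rewrite (hc (n - j)) ?mulr0//; lia.
apply: eq_isum => j; rewrite (isum_distrl _ (isupp_conv _ fa gb)).
by apply: eq_isum => i; rewrite mulrA.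
Qed.

Fact lmul1 : left_id (mono 0 1) lmul.
Proof.
move=> f; apply: laurent_ext => n /=; rewrite [LHS](@isum1 _ 0) /= ?mul1r ?subr0//.
by move=> i /negPf ->; rewrite mul0r.
Qed.

Fact lmulDl : left_distributive lmul (@ladd R).
Proof.
move=> f g h; apply: laurent_ext => n /=.
have [N [_ fN gN]] := order_ge_common f g; have [c hc] := lcoefP h.
rewrite -(isum_add (isupp_conv n fN hc) (isupp_conv n gN hc)).
by apply: eq_isum => i; rewrite mulrDl.
Qed.

Fact lone_neq0 : mono 0 1 != 0 :> laurent R.
Proof. by apply/eqP => /(congr1 (fun f : laurent R => f 0)) /= /eqP; rewrite oner_eq0. Qed.

HB.instance Definition _ :=
  GRing.Zmodule_isComNzRing.Build (laurent R) lmulA lmulC lmul1 lmulDl lone_neq0.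

Lemma coeflM f g n : (f * g) n = isum (fun i => f i * g (n - i)).
Proof. by []. Qed.

Lemma coefl1 n : (1 : laurent R) n = (n == 0)%:R.
Proof. by rewrite /=; case: eqP. Qed.

Lemma order_geM a b f g : order_ge a f -> order_ge b g -> order_ge (a + b) (f * g).
Proof. exact: order_ge_conv. Qed.

Lemma order_geM0 f g : order_ge 0 f -> order_ge 0 g -> order_ge 0 (f * g).
Proof. by move=> f0 g0; rewrite -[X in order_ge X]addr0; exact: order_geM. Qed.

Lemma coeflM_low a b f g : order_ge a f -> order_ge b g -> (f * g) (a + b) = f a * g b.
Proof.
move=> fa gb; rewrite coeflM (@isum1 _ a).
  by congr (_ * g _); lia.
move=> i ia; have [?|ai] := ltP i a; first by rewrite fa// mul0r.
by rewrite gb ?mulr0//; lia.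
Qed.

Lemma coef_monoM k c f n : (mono k c * f) n = c * f (n - k).
Proof.
rewrite coeflM (@isum1 _ k) /= ?eqxx// => i /negPf ->.
by rewrite mul0r.
Qed.

Lemma monoM k l c d : mono k c * mono l d = mono (k + l) (c * d).
Proof.
apply: laurent_ext => n; rewrite coef_monoM /= subr_eq [l + k]addrC.
by case: eqP; rewrite ?mulr0.
Qed.

Lemma lmul_nat n f k : (n%:R * f) k = n%:R * f k.
Proof.
elim: n => [|n IHn]; first by rewrite !mul0r.
by rewrite !mulrS !mulrDl coeflD !mul1r IHn.
Qed.

Lemma order_ge_eq0 f : (forall a, order_ge a f) -> f = 0.
Proof. by move=> f0; apply: laurent_ext => n; apply: (f0 (n + 1)); lia. Qed.

(** This locality of the product allows a geometric series to be replaced by a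
    partial sum in each degree. *)
Lemma eq_lmul_below f f' g n : order_ge 0 g -> (forall i, i <= n -> f i = f' i) ->
  (f * g) n = (f' * g) n.
Proof.
move=> g0 ff'; rewrite !coeflM; apply: eq_isum => i.
have [ni|ni] := leP i n; first by rewrite ff'.
by rewrite g0 ?mulr0//; lia.
Qed.

Lemma order_geX a f k : order_ge a f -> order_ge (a * k%:Z) (f ^+ k).
Proof.
move=> fa; elim: k => [|k IHk]; first by rewrite mulr0; exact: order_ge_mono.
rewrite exprS (_ : a * k.+1%:Z = a + a * k%:Z); last by lia.
exact: order_geM.
Qed.

End LaurentRing.

Arguments isupp_conv {R a b f g} n fa gb : rename.

(** * Invertible Laurent series *)

Section ClassicalInverse.
Variable T : comNzRingType.

(** Classically every commutative ring carries a unit-ring structure; the same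
    inverse serves Laurent series and the square-zero extension below. *)
Definition cunit : {pred T} := fun x => `[< exists y, y * x = 1 >].

Definition cinv (x : T) : T :=
  if pselect (exists y, y * x = 1) is left ex then projT1 (cid ex) else x.

Fact cmulVr : {in cunit, left_inverse 1 cinv *%R}.
Proof.
move=> x /asboolP ex; rewrite /cinv; case: pselect => // ex'.
by case: cid.
Qed.

Fact cunitPl (x y : T) : y * x = 1 -> cunit x.
Proof. by move=> yx; apply/asboolP; exists y. Qed.

Fact cinv_out : {in [predC cunit], cinv =1 id}.
Proof.
move=> x; rewrite inE /cinv => /asboolPn nex.
by case: pselect.
Qed.

End ClassicalInverse.

HB.instance Definition _ (R : comNzRingType) :=
  GRing.ComNzRing_hasMulInverse.Build (laurent R)
    (@cmulVr (laurent R)) (@cunitPl (laurent R)) (@cinv_out (laurent R)).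

Section LaurentUnits.
Variable R : comUnitRingType.
Implicit Types f g : laurent R.

Lemma geometric_inverse f : order_ge 1 f -> exists g, (1 - f) * g = 1 /\ order_ge 0 g.
Proof.
move=> f1; pose s n := \sum_(i < n) f ^+ i.
have sE m n i : (i < m%:Z)%R -> (m <= n)%N -> s n i = s m i.
  move=> im; elim: n => [|n IHn]; first by rewrite leqn0 => /eqP ->.
  rewrite leq_eqVlt => /predU1P[-> //|mn].
  rewrite /s big_ord_recr /= -/(s n) (@order_geX _ _ _ n f1) ?addr0; first exact: IHn.
  by lia.
have s0 n : order_ge 0 (s n).
  move=> i i0; elim: n => [|n IHn]; first by rewrite /s big_ord0.
  rewrite /s big_ord_recr /= -/(s n) IHn (@order_geX _ _ _ n f1) ?addr0//.
  by lia.
pose g n := s `|n|.+1 n.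
have g0 : order_ge 0 g by move=> n n0; rewrite /g s0.
exists (@Laurent _ g (ex_intro _ 0 g0)); split => //.
apply: laurent_ext => n; have [n0|n0] := ltP n 0.
  rewrite coefl1 (@order_geM0 _ (1 - f)) ?lt_eqF// => i i0.
  by rewrite coeflB coefl1 lt_eqF// f1 ?subr0//; lia.
have -> : ((1 - f) * @Laurent _ g (ex_intro _ 0 g0)) n = ((1 - f) * s `|n|.+1) n.
  rewrite [in LHS]mulrC [in RHS]mulrC; apply: eq_lmul_below => [i i0|i ni].
    by rewrite coeflB coefl1 lt_eqF// f1 ?subr0//; lia.
  rewrite /=; have [i0|i0] := ltP i 0; first by rewrite g0// s0.
  by rewrite /g (sE `|i|.+1)//; lia.
rewrite -[_ * _]opprK -mulNr opprB -subrX1 opprB coeflB.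
by rewrite (@order_geX _ _ _ _ f1) ?subr0//; lia.
Qed.

(** Write f = u z^N (1 - t) with u the lowest coefficient and t of order at
    least 1, and invert 1 - t by the geometric series. *)
Lemma low_unit_inverse N f : order_ge N f -> f N \is a GRing.unit ->
  exists g, f * g = 1 /\ order_ge (- N) g.
Proof.
move=> fN fNu; pose u := f N.
pose t := 1 - mono (- N) u^-1 * f.
have t1 : order_ge 1 t.
  move=> n n1; rewrite coeflB coefl1 coef_monoM.
  have [->|n0] := eqVneq n 0; first by rewrite opprK add0r mulVr ?subrr.
  by rewrite fN ?mulr0 ?subr0//; lia.
have [g [tg g0]] := geometric_inverse t1.
exists (mono (- N) u^-1 * g); split; last first.
  by rewrite -[X in order_ge X]addr0; apply: order_geM => //; exact: order_ge_mono.
by rewrite -tg mulrA; congr (_ * g); rewrite /t subKr mulrC.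
Qed.

Lemma low_unit N f : order_ge N f -> f N \is a GRing.unit ->
  f \is a GRing.unit /\ order_ge (- N) (f^-1)%R.
Proof.
move=> fN /(low_unit_inverse fN) [g [fg gN]].
have fu : f \is a GRing.unit by apply/unitrP; exists g; rewrite mulrC.
by split=> //; rewrite (_ : f^-1 = g)// -[LHS]mulr1 -fg mulKr.
Qed.

End LaurentUnits.

(** * Derivations of Laurent series and divided powers *)

Section Laurentmap.
Variables (M N : zmodType) (h : {additive M -> N}).

Fact lmap_subproof (f : laurent M) : is_laurent (fun n => h (f n)).
Proof. by have [a fa] := lcoefP f; exists a => n na; rewrite fa// raddf0. Qed.
Definition lmap f := Laurent (lmap_subproof f).

Fact lmap_is_zmod_morphism : zmod_morphism lmap.
Proof. by move=> f g; apply: laurent_ext => n /=; rewrite raddfB. Qed.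
HB.instance Definition _ :=
  GRing.isZmodMorphism.Build (laurent M) (laurent N) lmap lmap_is_zmod_morphism.

Lemma order_ge_lmap a (f : laurent M) : order_ge a f -> order_ge a (lmap f).
Proof. by move=> fa n na /=; rewrite fa// raddf0. Qed.

End Laurentmap.

Section LaurentRmorphism.
Variables (R S : comNzRingType) (h : {rmorphism R -> S}).

Fact lmap_is_monoid_morphism : monoid_morphism (lmap h).
Proof.
split=> [|f g]; apply: laurent_ext => n /=.
  by case: eqP => _; rewrite ?rmorph1 ?rmorph0.
have [[a fa] [b gb]] := (lcoefP f, lcoefP g).
rewrite [LHS](@isum_morph _ _ h _ _ _ _ _ (isupp_conv n fa gb)) ?rmorph0//; last exact: rmorphD.
by apply: eq_isum => i; rewrite rmorphM.
Qed.
HB.instance Definition _ := GRing.isMonoidMorphism.Build (laurent R) (laurent S)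
  (lmap h) lmap_is_monoid_morphism.

End LaurentRmorphism.

Section LaurentConst.
Variable R : comNzRingType.

Definition lconst (c : R) : laurent R := mono 0 c.

Fact lconst_is_zmod_morphism : zmod_morphism lconst.
Proof. by move=> c d; rewrite /lconst monoD monoN. Qed.
HB.instance Definition _ :=
  GRing.isZmodMorphism.Build R (laurent R) lconst lconst_is_zmod_morphism.
Fact lconst_is_monoid_morphism : monoid_morphism lconst.
Proof. by split=> // c d; rewrite /lconst monoM addr0. Qed.
HB.instance Definition _ :=
  GRing.isMonoidMorphism.Build R (laurent R) lconst lconst_is_monoid_morphism.

Lemma coef_lconstM c (f : laurent R) n : (lconst c * f) n = c * f n.
Proof. by rewrite coef_monoM subr0. Qed.

Lemma order_ge_lconst c : order_ge 0 (lconst c).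
Proof. exact: order_ge_mono. Qed.

End LaurentConst.

(** The form of being a rational algebra that divided powers use: every n! is
    then invertible. *)
Definition qalg (T : comUnitRingType) := forall n, (n.+1%:R : T) \is a GRing.unit.

Lemma qalg_laurent (R : comUnitRingType) : qalg R -> qalg (laurent R).
Proof.
move=> QR n; rewrite -[_%:R](rmorph_nat (@lconst R)).
have [||//] := @low_unit R 0 (lconst n.+1%:R); first exact: order_ge_lconst.
exact: QR.
Qed.

Definition derivation (T : comNzRingType) (d : {additive T -> T}) : Prop :=
  forall f g, d (f * g) = d f * g + f * d g.

Section Derivative.
Variable R : comNzRingType.
Implicit Types f g : laurent R.

Fact deriv_subproof f : is_laurent (fun n => (n + 1)%:~R * f (n + 1)).
Proof.
by have [a fa] := lcoefP f; exists (a - 1) => n na; rewrite fa ?mulr0//; lia.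
Qed.
Definition deriv f := Laurent (deriv_subproof f).

Fact deriv_is_zmod_morphism : zmod_morphism deriv.
Proof. by move=> f g; apply: laurent_ext => n /=; rewrite mulrBr. Qed.
HB.instance Definition _ :=
  GRing.isZmodMorphism.Build (laurent R) (laurent R) deriv deriv_is_zmod_morphism.

Lemma coef_deriv f n : deriv f n = (n + 1)%:~R * f (n + 1). Proof. by []. Qed.

Lemma residue_deriv f : deriv f (- 1) = 0.
Proof. by rewrite coef_deriv addNr mul0r. Qed.

Lemma derivM : derivation deriv.
Proof.
move=> f g; apply: laurent_ext => n.
have [[a fa] [b gb]] := (lcoefP f, lcoefP g).
rewrite coef_deriv coeflD !coeflM.
rewrite (isum_distrr _ (isupp_conv _ fa gb)).
transitivity (isum (fun i => i%:~R * f i * g (n + 1 - i)) +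
              isum (fun i => f i * ((n + 1 - i)%:~R * g (n + 1 - i)))).
  rewrite -(@isum_add _ a (n + 1 - b + 1)).
  - apply: eq_isum => i.
    have -> : (n + 1)%:~R = i%:~R + (n + 1 - i)%:~R :> R.
      by rewrite -intrD; congr (_%:~R); lia.
    by ring.
  - by move=> i /(isupp_conv (n + 1) fa gb); rewrite -mulrA => ->; rewrite mulr0.
  - by move=> i /(isupp_conv (n + 1) fa gb); rewrite mulrCA => ->; rewrite mulr0.
congr (_ + _).
  rewrite -(isum_shift 1); apply: eq_isum => i /=.
  by congr (_ * g _); lia.
apply: eq_isum => i /=.
by congr (_ * (_%:~R * g _)); lia.
Qed.

Lemma deriv_lconst c : deriv (lconst c) = 0.
Proof.
by apply: laurent_ext => n /=; case: eqP => [->|_]; rewrite ?mul0r ?mulr0.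
Qed.

Lemma deriv1 : deriv 1 = 0.
Proof. exact: (deriv_lconst 1). Qed.

Lemma derivXS n f : deriv (f ^+ n.+1) = n.+1%:R * f ^+ n * deriv f.
Proof.
elim: n => [|n IHn]; first by rewrite expr1 expr0 !mul1r.
rewrite exprS derivM /= IHn [in RHS]exprS [n.+2%:R]mulrSr.
by set g := f ^+ n; rewrite [f ^+ n.+1]exprS -/g; ring.
Qed.

Lemma deriv_mono k c : deriv (mono k c) = mono (k - 1) (k%:~R * c).
Proof.
apply: laurent_ext => n /=; have [->|nk] := eqVneq n (k - 1).
  by rewrite subrK eqxx.
by rewrite (_ : (n + 1 == k) = false) ?mulr0//; lia.
Qed.

Lemma order_ge_deriv a f : order_ge a f -> order_ge (a - 1) (deriv f).
Proof. by move=> fa n na; rewrite coef_deriv fa ?mulr0//; lia. Qed.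

Lemma order_ge0_deriv f : order_ge 0 f -> order_ge 0 (deriv f).
Proof.
move=> f0 n n0; rewrite coef_deriv; have [n1|n1] := ltP (n + 1) 0.
  by rewrite f0// mulr0.
by rewrite (_ : n + 1 = 0) ?mul0r//; lia.
Qed.

End Derivative.

Lemma derivV (R : comUnitRingType) (f : laurent R) : f \is a GRing.unit ->
  deriv f^-1%R = - (f^-1 ^+ 2 * deriv f).
Proof.
move=> fu; have := derivM f^-1%R f; rewrite /= mulVr// deriv1.
move=> /(congr1 (fun g => f^-1 * g)); rewrite mulr0 mulrDr.
set g := deriv _; rewrite [f^-1 * (g * f)]mulrCA mulVr// mulr1 mulrA -expr2.
by move=> /esym/eqP; rewrite addr_eq0 => /eqP.
Qed.

Lemma deriv_lmap (R S : comNzRingType) (h : {additive R -> S}) (f : laurent R) :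
  deriv (lmap h f) = lmap h (deriv f).
Proof. by apply: laurent_ext => n /=; rewrite !mulrzl raddfMz. Qed.

Section ScaledDerivation.
Variables (T : comNzRingType) (q : T) (d : {additive T -> T}).

Definition scale_der f := q * d f.
Fact scale_der_is_zmod_morphism : zmod_morphism scale_der.
Proof. by move=> f g; rewrite /scale_der raddfB mulrBr. Qed.
HB.instance Definition _ :=
  GRing.isZmodMorphism.Build T T scale_der scale_der_is_zmod_morphism.

Lemma scale_derM : derivation d -> derivation scale_der.
Proof. by move=> dM f g; rewrite /= /scale_der dM mulrDr mulrA mulrCA. Qed.

End ScaledDerivation.

Lemma coef_mono (M : zmodType) k (c : M) n : mono k c n = if n == k then c else 0.
Proof. by []. Qed.

Lemma coef_lconst (R : comNzRingType) (c : R) n : lconst c n = if n == 0 then c else 0.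
Proof. by []. Qed.

Lemma coef_lmap (M N : zmodType) (h : {additive M -> N}) (f : laurent M) n :
  lmap h f n = h (f n).
Proof. by []. Qed.

(* A product is a Laurent record whose coefficient function would otherwise be
   exposed as a raw sum by simplification. *)
#[global] Arguments lcoef : simpl never.

Section DividedPowers.
Variables (T : comUnitRingType) (d : {additive T -> T}).
Hypothesis QT : qalg T.

Definition divpow n f := (n`!%:R)^-1 * iter n d f.

Lemma fact_unit n : (n`!%:R : T) \is a GRing.unit.
Proof. by have := QT n`!.-1; rewrite prednK ?fact_gt0. Qed.

Lemma additive_natl n f : d (n%:R * f) = n%:R * d f.
Proof. by rewrite !mulr_natl raddfMn. Qed.

Lemma additive_invl n f : (n%:R : T) \is a GRing.unit -> d (n%:R^-1 * f) = n%:R^-1 * d f.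
Proof. by move=> un; apply: (mulrI un); rewrite -additive_natl !mulVKr. Qed.

Lemma divpow0 f : divpow 0 f = f.
Proof. by rewrite /divpow fact0 invr1 mul1r. Qed.

Lemma divpowSl n f : n.+1%:R * divpow n.+1 f = d (divpow n f).
Proof.
rewrite /divpow additive_invl ?fact_unit// -iterS factS natrM invrM ?fact_unit//.
by rewrite [LHS]mulrA [_.+1%:R * _]mulrCA mulrV// mulr1.
Qed.

Lemma divpow_comm (c : {additive T -> T}) : (forall f, c (d f) = d (c f)) ->
  forall n f, c (divpow n f) = divpow n (c f).
Proof.
move=> cd n f; apply: (mulrI (fact_unit n)); rewrite mulVKr ?fact_unit//.
rewrite !mulr_natl -raddfMn -mulr_natl mulVKr ?fact_unit//.
by elim: n => //= n <-.
Qed.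

Lemma divpowMl c : (forall f, d (c * f) = c * d f) ->
  forall n f, divpow n (c * f) = c * divpow n f.
Proof.
move=> dc n f; rewrite /divpow mulrCA; congr (_ * _).
by elim: n => //= n ->.
Qed.

Lemma divpowSr n f : n.+1%:R * divpow n.+1 f = divpow n (d f).
Proof. by rewrite divpowSl divpow_comm. Qed.

Fact divpow_is_zmod_morphism n : zmod_morphism (divpow n).
Proof.
move=> f g; rewrite /divpow -mulrBr; congr (_ * _).
by elim: n => //= n ->; rewrite raddfB.
Qed.
HB.instance Definition _ n :=
  GRing.isZmodMorphism.Build T T (divpow n) (divpow_is_zmod_morphism n).

Lemma divpow_eq0 n f : d f = 0 -> divpow n.+1 f = 0.
Proof.
by move=> df; apply: (mulrI (QT n)); rewrite divpowSr df raddf0 mulr0.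
Qed.

End DividedPowers.

(** * The exponential of a derivation *)

(** Power series over a rational algebra are determined by their constant term
    and their derivative. A whole family is compared at once, because the
    derivative of one member of the family usually involves other members. *)
Lemma eq_of_deriv (T : comUnitRingType) (X : Type) (F G : X -> laurent T) :
    qalg T -> (forall x, order_ge 0 (F x)) -> (forall x, order_ge 0 (G x)) ->
    (forall x, F x 0 = G x 0) ->
    (forall n : nat, (forall x, F x n = G x n) ->
       forall x, deriv (F x) n = deriv (G x) n) ->
  forall x, F x = G x.
Proof.
move=> QT F0 G0 FG0 FGS x; apply: laurent_ext => -[n|n]; last by rewrite F0 ?G0.
elim: n x => [|n IHn] x; first exact: FG0.
have := FGS n IHn x; rewrite !coef_deriv (_ : n%:Z + 1 = n.+1%:Z); last by lia.
exact: (mulrI (QT n)).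
Qed.

Section Exponential.
Variables (T : comUnitRingType) (d : {additive T -> T}).
Hypotheses (QT : qalg T) (dM : derivation d).
Implicit Types (f g : T) (F G : laurent T).

Definition exp_coef f (m : int) : T := if m is Posz n then divpow d n f else 0.

Fact expd_subproof f : is_laurent (exp_coef f).
Proof. by exists 0; case. Qed.
Definition expd f := Laurent (expd_subproof f).

Lemma coef_expd f (n : nat) : expd f n = divpow d n f. Proof. by []. Qed.

Lemma order_ge_expd f : order_ge 0 (expd f).
Proof. by case. Qed.

Fact expd_is_zmod_morphism : zmod_morphism expd.
Proof.
move=> f g; apply: laurent_ext => -[n|n]; rewrite coeflB.
  by rewrite !coef_expd raddfB.
by rewrite !order_ge_expd// subr0.
Qed.
HB.instance Definition _ :=
  GRing.isZmodMorphism.Build T (laurent T) expd expd_is_zmod_morphism.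

Lemma expd_0 f : expd f 0 = f.
Proof. by rewrite coef_expd divpow0. Qed.

Lemma order_ge0_ext F G : order_ge 0 F -> order_ge 0 G -> (forall n : nat, F n = G n) -> F = G.
Proof. by move=> F0 G0 FG; apply: laurent_ext => -[n|n]; rewrite ?FG// F0 ?G0. Qed.

(** d/dz e^{zd} f = e^{zd} d f. Together with the constant term f this
    characterises e^{zd} f, and it drives all the inductions on coefficients. *)
Lemma deriv_expd f : deriv (expd f) = expd (d f).
Proof.
apply: order_ge0_ext => [||n]; [|exact: order_ge_expd|].
  by apply: order_ge0_deriv; exact: order_ge_expd.
by rewrite coef_deriv (_ : n%:Z + 1 = n.+1%:Z) ?coef_expd ?divpowSr//; lia.
Qed.

Lemma lmap_expd f : lmap d (expd f) = expd (d f).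
Proof.
apply: order_ge0_ext => [||n]; [|exact: order_ge_expd|].
  by apply: order_ge_lmap; exact: order_ge_expd.
by rewrite coef_lmap !coef_expd divpow_comm.
Qed.

Lemma expd_const f : d f = 0 -> expd f = lconst f.
Proof.
move=> df; apply: order_ge0_ext => [||[|n]]; [exact: order_ge_expd|exact: order_ge_lconst| |].
  by rewrite expd_0.
by rewrite coef_expd divpow_eq0.
Qed.

Lemma derivation1 : d 1 = 0.
Proof. by have /eqP := dM 1 1; rewrite !mulr1 mul1r -subr_eq0 opprD addNKr oppr_eq0 => /eqP. Qed.

(** Both sides have constant term f g, and by Leibniz their z-derivatives are
    the same expression applied to (d f, g) and (f, d g). *)
Fact expdM : {morph expd : f g / f * g}.
Proof.
move=> f g.
apply: (@eq_of_deriv _ (T * T)%type (fun x => expd (x.1 * x.2))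
  (fun x => expd x.1 * expd x.2) QT _ _ _ _ (f, g)) => [x|x|[x y]|n IHn [x y]] /=.
- exact: order_ge_expd.
- by apply: order_geM0; exact: order_ge_expd.
- have := coeflM_low (order_ge_expd x) (order_ge_expd y).
  by rewrite addr0 !expd_0.
- rewrite deriv_expd dM raddfD derivM /= !deriv_expd !coeflD.
  by rewrite (IHn (d x, y)) (IHn (x, d y)).
Qed.

Lemma expd1 : expd 1 = 1.
Proof. by rewrite expd_const ?derivation1. Qed.

Fact expdL_subproof F : is_laurent (fun n => isum (fun i => expd (F i) (n - i))).
Proof.
have [a Fa] := lcoefP F; exists a => n na; apply: isum0 => i.
have [ia|ai] := ltP i a; first by rewrite Fa// raddf0.
by rewrite order_ge_expd//; lia.
Qed.
(** The operator e^{zd} acting on T((z)), with d applied to coefficients: the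
    sum over i of z^i e^{zd} F_i. *)
Definition expdL F := Laurent (expdL_subproof F).

Lemma isupp_expdL a F n : order_ge a F -> isupp a (n + 1) (fun i => expd (F i) (n - i)).
Proof.
move=> Fa i ia; have [?|ai] := ltP i a; first by rewrite Fa// raddf0.
by rewrite order_ge_expd//; lia.
Qed.

Lemma coef_expdL F n : expdL F n = isum (fun i => expd (F i) (n - i)).
Proof. by []. Qed.

Lemma order_ge_expdL a F : order_ge a F -> order_ge a (expdL F).
Proof.
move=> Fa n na; apply: isum0 => i.
by rewrite (isupp_expdL (n := n) Fa)//; lia.
Qed.

Lemma expdL_lconst f : expdL (lconst f) = expd f.
Proof.
apply: laurent_ext => n; rewrite coef_expdL (@isum1 _ 0) ?subr0//.
by move=> i /negPf i0; rewrite coef_lconst i0 raddf0.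
Qed.

Lemma deriv_expdL F : deriv (expdL F) = expdL (deriv F) + lmap d (expdL F).
Proof.
have [a Fa] := lcoefP F; apply: laurent_ext => n.
rewrite coeflD coef_deriv coef_lmap !coef_expdL.
rewrite -(isum_shift (-1) (fun i => expd (deriv F i) (n - i))).
rewrite (@isum_morph _ _ d _ _ _ (raddf0 d) (raddfD d) (isupp_expdL (n := n) Fa)).
rewrite (isum_distrr _ (isupp_expdL Fa)).
rewrite -(@isum_add _ a (n + 2)).
- apply: eq_isum => i.
  rewrite coef_deriv subrK !mulrzl raddfMz -[d _](coef_lmap d) lmap_expd -deriv_expd.
  rewrite coef_deriv [n - i + 1]addrAC mulrzl (_ : n - (i + - 1) = n + 1 - i); last by lia.
  by rewrite coeflMz -mulrzDr; congr (_ *~ _); lia.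
- move=> i ia; have [?|ai] := ltP i a.
    by rewrite (order_ge_deriv Fa) ?raddf0//; lia.
  by rewrite order_ge_expd//; lia.
- by move=> i ia; rewrite (isupp_expdL Fa) ?raddf0//; lia.
Qed.

Fact expdL_is_zmod_morphism : zmod_morphism expdL.
Proof.
move=> F G; apply: laurent_ext => n; have [N [_ FN GN]] := order_ge_common F G.
rewrite coeflB !coef_expdL -(isum_sub (isupp_expdL FN) (isupp_expdL GN)).
by apply: eq_isum => i; rewrite coeflB raddfB.
Qed.
HB.instance Definition _ :=
  GRing.isZmodMorphism.Build (laurent T) (laurent T) expdL expdL_is_zmod_morphism.

Lemma expdL_mono k f : expdL (mono k f) = mono k 1 * expd f.
Proof.
apply: laurent_ext => n; rewrite coef_expdL coef_monoM mul1r (@isum1 _ k).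
  by rewrite coef_mono eqxx.
by move=> i /negPf ik; rewrite coef_mono ik raddf0.
Qed.

(** By continuity in each argument it suffices to compare monomials, where the
    claim is multiplicativity of e^{zd} on T. *)
Lemma expdLM : {morph expdL : F G / F * G}.
Proof.
move=> F G; apply/eqP; rewrite -subr_eq0; apply/eqP; move: F.
have [c Gc] := lcoefP G.
apply: (@laurent_dense _ _ (fun F => expdL (F * G) - expdL F * expdL G) c).
- by move=> F F' /=; rewrite raddfB mulrBl raddfB /= mulrBl; ring.
- move=> k f; move: G {c Gc}.
  apply: (@laurent_dense _ _ (fun G => expdL (mono k f * G) - expdL (mono k f) * expdL G) k).
  + by move=> F F' /=; rewrite raddfB mulrBr raddfB /= mulrBr; ring.
  + move=> l g; rewrite monoM !expdL_mono expdM mulrACA monoM mulr1 subrr//.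
  + move=> a F Fa n; rewrite addrC coeflB => na.
    have fk : order_ge k (mono k f) by exact: order_ge_mono.
    rewrite (order_ge_expdL (order_geM fk Fa))//.
    rewrite (order_geM (order_ge_expdL fk) (order_ge_expdL Fa))//.
    by rewrite subr0.
- move=> a F Fa n na; rewrite coeflB.
  rewrite (order_ge_expdL (order_geM Fa Gc))//.
  rewrite (order_geM (order_ge_expdL Fa) (order_ge_expdL Gc))//.
  by rewrite subr0.
Qed.

End Exponential.

(** The substitution z -> -z. *)
Definition sgnl_coef (M : zmodType) (F : int -> M) : int -> M :=
  fun n => F n *~ (-1) ^+ `|n|.

Lemma signz_mul i j : (-1 : int) ^+ `|i| * (-1) ^+ `|j| = (-1) ^+ `|(i + j)%R|%N.
Proof.
have E : odd (`|i| + `|j|) = odd `|(i + j)%R| by lia.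
by rewrite -exprD -[LHS]signr_odd E signr_odd.
Qed.

Section SignChange.
Variable R : comNzRingType.
Implicit Types F G : laurent R.

Fact sgnl_subproof F : is_laurent (sgnl_coef F).
Proof.
by have [a Fa] := lcoefP F; exists a => n na; rewrite /sgnl_coef Fa// mul0rz.
Qed.
Definition sgnl F := Laurent (sgnl_subproof F).

Lemma coef_sgnl F n : sgnl F n = F n *~ (-1) ^+ `|n|. Proof. by []. Qed.

Lemma sgnlM : {morph sgnl : F G / F * G}.
Proof.
move=> F G; apply: laurent_ext => n; rewrite coef_sgnl !coeflM.
have [[a Fa] [b Gb]] := (lcoefP F, lcoefP G).
rewrite -mulrzl (isum_distrr _ (isupp_conv _ Fa Gb)).
apply: eq_isum => i; rewrite mulrzl !coef_sgnl mulrzAr mulrzAl -mulrzA signz_mul.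
by rewrite [i + _]addrC subrK.
Qed.

Lemma sgnl_lconst c : sgnl (lconst c) = lconst c.
Proof.
apply: laurent_ext => n; rewrite coef_sgnl coef_lconst.
by case: eqP => [->|]; rewrite ?mul0rz// mulr1z.
Qed.

Lemma deriv_sgnl F : deriv (sgnl F) = - sgnl (deriv F).
Proof.
apply: laurent_ext => n; rewrite coeflN coef_sgnl !coef_deriv coef_sgnl.
rewrite mulrzAr -mulrNz; congr (_ *~ _).
have E : odd `|(n + 1)%R| = odd `|n|.+1 by lia.
by rewrite -signr_odd E signr_odd exprS mulN1r.
Qed.

Lemma order_ge_sgnl a F : order_ge a F -> order_ge a (sgnl F).
Proof. by move=> Fa n na; rewrite coef_sgnl Fa// mul0rz. Qed.

End SignChange.

(** * Series in two variables and the diagonal *)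

Section Diagonal.
Variable R : comUnitRingType.
Implicit Types (A B : laurent (laurent R)) (f g : laurent R).

Definition order_ge2 N A : Prop := order_ge N A /\ forall a, order_ge N (A a).
(** Elements of R((z1, z2)) inside R((z2))((z1)): bounded below in both
    exponents, so that z1 = z2 may be substituted. *)
Definition bounded2 A : Prop := exists N, order_ge2 N A.

Lemma order_ge2W N N' A : N' <= N -> order_ge2 N A -> order_ge2 N' A.
Proof. by move=> NN' [A1 A2]; split=> [|a]; apply: order_geW NN' _. Qed.

Lemma bounded2_common A B : bounded2 A -> bounded2 B ->
  exists N, [/\ N <= 0, order_ge2 N A & order_ge2 N B].
Proof.
move=> [a Aa] [b Bb]; exists (- (`|a| + `|b|)%N%:Z); split; first by lia.
  by apply: order_ge2W Aa; lia.
by apply: order_ge2W Bb; lia.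
Qed.

Lemma bounded2B A B : bounded2 A -> bounded2 B -> bounded2 (A - B).
Proof.
move=> bA bB; have [N [_ [A1 A2] [B1 B2]]] := bounded2_common bA bB.
exists N; split=> [n nN|a n nN].
  by rewrite coeflB A1// B1// subr0.
by rewrite !coeflB A2// B2// subr0.
Qed.

Lemma bounded2_0 : bounded2 0.
Proof. by exists 0; split. Qed.

Lemma bounded2N A : bounded2 A -> bounded2 (- A).
Proof. by move=> bA; rewrite -sub0r; exact: bounded2B bounded2_0 bA. Qed.

Lemma bounded2M A B : bounded2 A -> bounded2 B -> bounded2 (A * B).
Proof.
move=> bA bB; have [N [_ [A1 A2] [B1 B2]]] := bounded2_common bA bB.
exists (N + N); split=> [n nN|a n nN]; first by rewrite (order_geM A1 B1).
rewrite coeflM (coefl_isum _ (isupp_conv a A1 B1)); apply: isum0 => i.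
exact: order_geM (A2 i) (B2 (a - i)) n nN.
Qed.

Lemma bounded2_lconst f : bounded2 (lconst f).
Proof.
have [N [N0 fN _]] := order_ge_common f f; exists N; split=> [n nN|a n nN].
  by rewrite order_ge_lconst//; lia.
by rewrite coef_lconst; case: eqP => _; [exact: fN|].
Qed.

(** The series f(z1), whose coefficients are constant in the inner variable z2;
    the series f(z2) is [lconst f]. *)
Definition lift1 : laurent R -> laurent (laurent R) := lmap (@lconst R).

Lemma coef_lift1 f a b : lift1 f a b = if b == 0 then f a else 0.
Proof. by []. Qed.

Lemma bounded2_lift1 f : bounded2 (lift1 f).
Proof.
have [N [N0 fN _]] := order_ge_common f f; exists N; split=> [|a n nN].
  exact: order_ge_lmap.
by rewrite coef_lift1 lt_eqF//; lia.
Qed.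

Lemma bounded2_deriv A : bounded2 A -> bounded2 (deriv A).
Proof.
move=> [N [A1 A2]]; exists (N - 1); split; first exact: order_ge_deriv.
move=> a n nN; rewrite coef_deriv mulrzl coeflMz A2 ?mul0rz//; lia.
Qed.

Lemma bounded2_lmap_deriv A : bounded2 A -> bounded2 (lmap (@deriv R) A).
Proof.
move=> [N [A1 A2]]; exists (N - 1); split.
  by apply: order_ge_lmap; apply: order_geW A1; lia.
by move=> a; rewrite coef_lmap; exact: order_ge_deriv.
Qed.

(** A(x, x). The value 0 on unbounded arguments makes the operation total. *)
Definition diagl A : laurent R :=
  if pselect (is_laurent (diag (fun a b => A a b))) is left pf then Laurent pf else 0.

Lemma isupp_diag N A n : order_ge2 N A -> isupp N (n - N + 1) (fun a => A a (n - a)).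
Proof.
move=> [A1 A2] a aN; have [?|?] := ltP a N; first by rewrite A1.
by rewrite A2//; lia.
Qed.

Lemma coef_diagl A n : bounded2 A -> diagl A n = isum (fun a => A a (n - a)).
Proof.
move=> [N AN]; rewrite /diagl; case: pselect => // -[].
exists (N + N) => {}n nN; apply: isum0 => a.
by rewrite (isupp_diag AN)//; lia.
Qed.

Lemma diaglB A B : bounded2 A -> bounded2 B -> diagl (A - B) = diagl A - diagl B.
Proof.
move=> bA bB; have [N [_ AN BN]] := bounded2_common bA bB.
apply: laurent_ext => n; rewrite coeflB !coef_diagl//; last exact: bounded2B.
by rewrite -(isum_sub (isupp_diag AN) (isupp_diag BN)).
Qed.

Lemma diagl0 : diagl 0 = 0.
Proof. by rewrite -[X in diagl X](subrr 0) (diaglB bounded2_0 bounded2_0) subrr. Qed.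

Lemma coef_lift1M f A a b : (lift1 f * A) a b = isum (fun i => f i * A (a - i) b).
Proof.
have [[c fc] [d Ad]] := (lcoefP f, lcoefP A).
rewrite coeflM (@coefl_isum _ c (a - d + 1)); last first.
  by apply: isupp_conv => //; exact: order_ge_lmap.
by apply: eq_isum => i; rewrite coef_lmap coef_lconstM.
Qed.

Lemma diagl_lift1M f A : bounded2 A -> diagl (lift1 f * A) = f * diagl A.
Proof.
move=> bA; have bfA : bounded2 (lift1 f * A).
  by apply: bounded2M => //; exact: bounded2_lift1.
apply: laurent_ext => n; rewrite coeflM coef_diagl//.
have [[N AN] [c fc]] := (bA, lcoefP f); have [A1 A2] := AN.
transitivity (isum (fun a => isum (fun i => f i * A (a - i) (n - a)))).
  by apply: eq_isum => a; rewrite coef_lift1M.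
rewrite (@isum_exchange _ (c + N) (n - N + 1) c (n - N - N + 1)); last first.
  move=> a i ai; have [?|ci] := ltP i c; first by rewrite fc// mul0r.
  have [?|Na] := ltP (a - i) N; first by rewrite A1// mulr0.
  by rewrite A2 ?mulr0//; lia.
apply: eq_isum => i; rewrite coef_diagl//.
rewrite (isum_distrr _ (isupp_diag AN)) -[LHS](isum_shift i).
by apply: eq_isum => a; congr (_ * A _ _); lia.
Qed.

Lemma diagl_lconstM f A : bounded2 A -> diagl (lconst f * A) = f * diagl A.
Proof.
move=> bA; have bfA : bounded2 (lconst f * A).
  by apply: bounded2M => //; exact: bounded2_lconst.
apply: laurent_ext => n; rewrite coeflM coef_diagl//.
have [[N AN] [c fc]] := (bA, lcoefP f); have [A1 A2] := AN.
transitivity (isum (fun a => isum (fun i => f i * A a (n - a - i)))).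
  by apply: eq_isum => a; rewrite coef_lconstM coeflM.
rewrite (@isum_exchange _ N (n - N - c + 1) c (n - N - N + 1)); last first.
  move=> a i ai; have [?|ci] := ltP i c; first by rewrite fc// mul0r.
  have [?|Na] := ltP a N; first by rewrite A1// mulr0.
  by rewrite A2 ?mulr0//; lia.
apply: eq_isum => i; rewrite coef_diagl//.
rewrite (isum_distrr _ (isupp_diag AN)).
by apply: eq_isum => a; congr (_ * A _ _); lia.
Qed.

Lemma diagl_lconst f : diagl (lconst f) = f.
Proof.
apply: laurent_ext => n; rewrite coef_diagl; last exact: bounded2_lconst.
rewrite (@isum1 _ 0) ?subr0 ?coef_lconst// => a /negPf a0.
by rewrite coef_lconst a0.
Qed.

(** The chain rule for x -> (x, x). *)
Lemma deriv_diagl A : bounded2 A ->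
  deriv (diagl A) = diagl (deriv A) + diagl (lmap (@deriv R) A).
Proof.
move=> bA; have [N AN] := bA; apply: laurent_ext => n.
rewrite coeflD coef_deriv !coef_diagl; [|exact: bounded2_lmap_deriv|exact: bounded2_deriv|by []].
rewrite (isum_distrr _ (isupp_diag AN)) -(isum_shift (-1) (fun a => deriv A a _)).
rewrite -(@isum_add _ N (n - N + 2)).
- apply: eq_isum => a; rewrite coef_lmap !coef_deriv mulrzl coeflMz subrK.
  rewrite !mulrzl (_ : n - (a + - 1) = n + 1 - a); last by lia.
  rewrite (_ : n - a + 1 = n + 1 - a); last by lia.
  by rewrite -mulrzDr; congr (_ *~ _); lia.
- move=> a aN; rewrite coef_deriv mulrzl coeflMz.
  rewrite (_ : A _ _ = 0) ?mul0rz// subrK.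
  have := isupp_diag AN (n := n + 1) (i := a).
  by rewrite (_ : n + 1 - a = n - (a - 1)); [apply; lia|lia].
- move=> a aN; rewrite coef_lmap coef_deriv.
  rewrite (_ : A _ _ = 0) ?mulr0//.
  have := isupp_diag AN (n := n + 1) (i := a).
  by rewrite (_ : n + 1 - a = n - a + 1); [apply; lia|lia].
Qed.

(** A relation rather than an operation, because exchanging the variables leaves
    R((z2))((z1)) in general. *)
Definition swapped A B : Prop := forall a b, A a b = B b a.

Lemma diagl_swapped A B : bounded2 A -> bounded2 B -> swapped A B -> diagl A = diagl B.
Proof.
move=> bA bB AB; apply: laurent_ext => n; rewrite !coef_diagl//.
by rewrite -[LHS](isum_rev n); apply: eq_isum => a; rewrite AB; congr (B _ _); lia.
Qed.

End Diagonal.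

Arguments bounded2_0 {R}.

(** * The substitution z1 = phi(z2, z0) *)

Section Substitution.
Variables (R : comUnitRingType) (p : laurent R).
Hypothesis QR : qalg R.
Implicit Types (A B : laurent (laurent R)) (f g : laurent R).

Let QL : qalg (laurent R) := qalg_laurent QR.
Let QLL : qalg (laurent (laurent R)) := qalg_laurent QL.

(** D = p(x) d/dx, and its versions D1 and D2 acting on z1 and on z2. *)
Definition pder := scale_der p (@deriv R).
HB.instance Definition _ := GRing.Additive.on pder.
Definition pder1 := scale_der (lift1 p) (@deriv (laurent R)).
HB.instance Definition _ := GRing.Additive.on pder1.
Definition pder2 := lmap pder.
HB.instance Definition _ := GRing.Additive.on pder2.

Lemma pderM : derivation pder.
Proof. by apply: scale_derM; exact: derivM. Qed.

Lemma pder1M A B : pder1 (A * B) = pder1 A * B + A * pder1 B.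
Proof. by apply: (@scale_derM _ (lift1 p) (@deriv (laurent R))); exact: derivM. Qed.

Lemma pder1_lconst f : pder1 (lconst f) = 0.
Proof. by rewrite /pder1 /scale_der /= deriv_lconst mulr0. Qed.

Lemma pder1_lconstM f A : pder1 (lconst f * A) = lconst f * pder1 A.
Proof. by rewrite pder1M pder1_lconst mul0r add0r. Qed.

Lemma pder1_lift1 f : pder1 (lift1 f) = lift1 (pder f).
Proof. by rewrite /pder1 /scale_der /= /lift1 deriv_lmap -rmorphM. Qed.

Lemma pder2E A : pder2 A = lconst p * lmap (@deriv R) A.
Proof. by apply: laurent_ext => n; rewrite coef_lconstM !coef_lmap. Qed.

Lemma bounded2_pder1 A : bounded2 A -> bounded2 (pder1 A).
Proof.
by move=> bA; apply: bounded2M; [exact: bounded2_lift1 | exact: bounded2_deriv].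
Qed.

Lemma bounded2_pder2 A : bounded2 A -> bounded2 (pder2 A).
Proof.
move=> bA; rewrite pder2E.
by apply: bounded2M; [exact: bounded2_lconst | exact: bounded2_lmap_deriv].
Qed.

Lemma pder_lconstM c f : pder (lconst c * f) = lconst c * pder f.
Proof. by rewrite /pder /scale_der derivM /= deriv_lconst mul0r add0r mulrCA. Qed.

Lemma pder12C A : pder1 (pder2 A) = pder2 (pder1 A).
Proof.
rewrite /pder1 /pder2 /scale_der /= deriv_lmap; apply: laurent_ext => a.
rewrite coef_lmap !coeflM.
have [[c pc] [N AN]] := (lcoefP p, lcoefP (deriv A)).
rewrite -[LHS]/(isum _) -[RHS]/(pder (isum _)).
rewrite (@isum_morph _ _ pder c (a - N + 1)); last 3 first.
- exact: raddf0.
- exact: raddfD.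
- by apply: isupp_conv => //; exact: order_ge_lmap.
apply: eq_isum => i; rewrite !coef_lmap -[LHS]/(lconst (p i) * pder _). 
by rewrite -[RHS]/(pder (lconst (p i) * deriv A (a - i))) pder_lconstM.
Qed.

Lemma invfact_lconst n :
  (n`!%:R : laurent (laurent R))^-1 = lconst (lconst (n`!%:R^-1)).
Proof.
rewrite -(rmorph_nat (@lconst (laurent R))) -(rmorph_nat (@lconst R)) /=.
by rewrite -!rmorphV ?rmorph_unit// /= ?rmorph_unit// fact_unit.
Qed.

Lemma bounded2_divpow (d : {additive laurent (laurent R) -> laurent (laurent R)}) n A :
  (forall B, bounded2 B -> bounded2 (d B)) -> bounded2 A -> bounded2 (divpow d n A).
Proof.
move=> bd bA; rewrite /divpow invfact_lconst.
apply: bounded2M; first exact: bounded2_lconst.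
by elim: n => //= n; exact: bd.
Qed.

Lemma bounded2_divpow1 n A : bounded2 A -> bounded2 (divpow pder1 n A).
Proof. exact/bounded2_divpow/bounded2_pder1. Qed.

Lemma bounded2_divpow2 n A : bounded2 A -> bounded2 (divpow pder2 n A).
Proof. exact/bounded2_divpow/bounded2_pder2. Qed.

Lemma diagl_natM n A : bounded2 A -> diagl (n%:R * A) = n%:R * diagl A.
Proof. by move=> bA; rewrite -(rmorph_nat (@lconst _)) diagl_lconstM. Qed.

Lemma pder_diagl A : bounded2 A -> pder (diagl A) = diagl (pder1 A) + diagl (pder2 A).
Proof.
move=> bA; rewrite /pder /scale_der /= deriv_diagl// mulrDr pder2E.
rewrite diagl_lconstM; last exact: bounded2_lmap_deriv.
by rewrite diagl_lift1M//; exact: bounded2_deriv.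
Qed.

(** The coefficients of (e^{z0 D1} A)(x, x), that is of A(phi(x, z0), x). *)
Definition tau_coef A (m : int) : laurent R :=
  if m is Posz n then diagl (divpow pder1 n A) else 0.
Fact tau_subproof A : is_laurent (tau_coef A).
Proof. by exists 0; case. Qed.
Definition tau A := Laurent (tau_subproof A).

Lemma coef_tau A (n : nat) : tau A n = diagl (divpow pder1 n A). Proof. by []. Qed.

Lemma order_ge_tau A : order_ge 0 (tau A). Proof. by case. Qed.

Lemma tau_0 A : tau A 0 = diagl A.
Proof. by rewrite coef_tau divpow0. Qed.

Lemma deriv_tau A : bounded2 A -> deriv (tau A) = tau (pder1 A).
Proof.
move=> bA; apply: order_ge0_ext => [||n]; [|exact: order_ge_tau|].
  by apply: order_ge0_deriv; exact: order_ge_tau.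
rewrite coef_deriv (_ : n%:Z + 1 = n.+1%:Z); last by lia.
rewrite !coef_tau -[RHS]/(diagl (divpow pder1 n (pder1 A))).
have <- : n.+1%:R * divpow pder1 n.+1 A = divpow pder1 n (pder1 A) by exact: divpowSr.
by rewrite (diagl_natM n.+1 (bounded2_divpow1 n.+1 bA)).
Qed.

Lemma tauB A B : bounded2 A -> bounded2 B -> tau (A - B) = tau A - tau B.
Proof.
move=> bA bB; apply: order_ge0_ext => [||n].
- exact: order_ge_tau.
- by move=> n n0; rewrite coeflB !order_ge_tau// subr0.
- rewrite coeflB !coef_tau raddfB diaglB//; exact: bounded2_divpow1.
Qed.

Lemma tau0 : tau 0 = 0.
Proof. by rewrite -[X in tau X](subrr 0) (tauB bounded2_0 bounded2_0) subrr. Qed.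

Lemma tauN A : bounded2 A -> tau (- A) = - tau A.
Proof.
by move=> bA; rewrite -[X in tau X]sub0r (tauB bounded2_0 bA) tau0 sub0r.
Qed.

Lemma tauD A B : bounded2 A -> bounded2 B -> tau (A + B) = tau A + tau B.
Proof.
by move=> bA bB; rewrite -[B]opprK (tauB bA (bounded2N bB)) tauN// !opprK.
Qed.

Lemma tau_lconstM f A : bounded2 A -> tau (lconst f * A) = lconst f * tau A.
Proof.
move=> bA; apply: order_ge0_ext => [||n].
- exact: order_ge_tau.
- by apply: order_geM0; [exact: order_ge_lconst | exact: order_ge_tau].
rewrite coef_lconstM !coef_tau -diagl_lconstM; last exact: bounded2_divpow1.
congr diagl; apply: divpowMl => B.
exact: pder1_lconstM.
Qed.

Lemma tau_lconst f : tau (lconst f) = lconst f.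
Proof.
apply: order_ge0_ext => [||[|n]]; [exact: order_ge_tau|exact: order_ge_lconst| |].
  by rewrite tau_0 diagl_lconst.
rewrite coef_tau (divpow_eq0 QLL n (pder1_lconst f)) diagl0.
by rewrite coef_lconst.
Qed.

(** Substitution turns f(z1) into f(phi(x, z0)) = e^{z0 D} f. Both sides agree
    at z0 = 0 and have the same z0-derivative by Leibniz. *)
Lemma tau_lift1M f A : bounded2 A -> tau (lift1 f * A) = expd pder f * tau A.
Proof.
have tM := fun h B (bB : bounded2 B) => bounded2M (bounded2_lift1 h) bB.
move=> bA; pose X := (laurent R * {B : laurent (laurent R) | bounded2 B})%type.
pose F (x : X) := tau (lift1 x.1 * sval x.2).
pose G (x : X) := expd pder x.1 * tau (sval x.2).
have FG : forall x, F x = G x; last exact: (FG (f, exist _ A bA)).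
apply: eq_of_deriv QL _ _ _ _ => [x|x|[g [B bB]]|n IHn [g [B bB]]]; rewrite /F /G /=.
- exact: order_ge_tau.
- by apply: order_geM0; [exact: order_ge_expd | exact: order_ge_tau].
- have := coeflM_low (order_ge_expd pder g) (order_ge_tau B).
  rewrite addr0 => ->; rewrite !tau_0 expd_0 diagl_lift1M//.
- rewrite deriv_tau; last exact: tM.
  rewrite pder1M pder1_lift1 derivM /= deriv_expd// deriv_tau// tauD; first last.
  + exact/tM/bounded2_pder1.
  + exact: tM.
  rewrite !coeflD.
  have := IHn (pder g, exist _ B bB); rewrite /F /G => <-.
  by have := IHn (g, exist _ _ (bounded2_pder1 bB)); rewrite /F /G => <-.
Qed.

(** Substitute z0 -> -z0 in A(phi(x, z0), x), then apply e^{z0 D} in x. As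
    e^{z0 D} carries phi(x, -z0) to x, the expected result is A(x, phi(x, z0)). *)
Definition tau_flip A := expdL pder (sgnl (tau A)).

(** The z0-derivative of the flipped series of A is D of it minus the flipped
    series of D1 A; the chain rule D = D1 + D2 on the diagonal leaves D2 alone. *)
Lemma tau_flipE n A : bounded2 A -> tau_flip A (n%:Z) = diagl (divpow pder2 n A).
Proof.
elim: n A => [|n IHn] A bA.
  have := order_ge_sgnl (order_ge_tau A) => s0.
  rewrite /tau_flip coef_expdL (@isum1 _ 0) ?subr0.
    by rewrite expd_0 coef_sgnl mulr1z tau_0 divpow0.
  move=> i i0; have [ineg|ipos] := ltP i 0; first by rewrite s0// raddf0.
  by rewrite order_ge_expd//; lia.
have dflip : deriv (tau_flip A) = - tau_flip (pder1 A) + lmap pder (tau_flip A).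
  rewrite /tau_flip (deriv_expdL pder QL) deriv_sgnl (deriv_tau bA) raddfN.
  by [].
have key : deriv (tau_flip A) n = n.+1%:R * diagl (divpow pder2 n.+1 A).
  rewrite dflip coeflD coeflN coef_lmap (IHn _ (bounded2_pder1 bA)) (IHn _ bA).
  rewrite -[X in _ + X]/(pder (diagl (divpow pder2 n A))).
  rewrite (pder_diagl (bounded2_divpow2 n bA)).
  have -> : divpow pder2 n (pder1 A) = pder1 (divpow pder2 n A).
    by apply/esym/(@divpow_comm _ pder2 QLL pder1) => B; exact: pder12C.
  rewrite addKr -(diagl_natM n.+1 (bounded2_divpow2 n.+1 bA)).
  by congr diagl; apply/esym; exact: divpowSl.
apply: (mulrI (QL n)); rewrite -key coef_deriv (_ : n%:Z + 1 = n.+1%:Z) //.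
by lia.
Qed.

Lemma divpow_swapped n A B : swapped A B -> swapped (divpow pder1 n A) (divpow pder2 n B).
Proof.
move=> AB a b; rewrite /divpow !invfact_lconst !coef_lconstM.
have : swapped (iter n pder1 A) (iter n pder2 B).
  elim: n {a b} => //= n IHn a b.
  rewrite /pder1 /scale_der /= coef_lift1M -[RHS]/(pder (iter n pder2 B b) a).
  rewrite /pder /scale_der coeflM; apply: eq_isum => i.
  by rewrite !coef_deriv mulrzl coeflMz mulrzl -IHn.
by move=> ->.
Qed.

Lemma tau_swapped A B : bounded2 A -> bounded2 B -> swapped A B -> tau A = tau_flip B.
Proof.
move=> bA bB AB; apply: order_ge0_ext => [||n]; first exact: order_ge_tau.
  by apply: order_ge_expdL; apply: order_ge_sgnl; exact: order_ge_tau.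
rewrite (tau_flipE n bB) coef_tau; apply: diagl_swapped.
- exact: bounded2_divpow1.
- exact: bounded2_divpow2.
- exact: divpow_swapped.
Qed.

End Substitution.

(** * Division by z1 - z2 *)

Section DiagonalDivision.
Variable R : comUnitRingType.
Implicit Types A B : laurent (laurent R).

(** The variable x. *)
Definition lX : laurent R := mono 1 1.
Definition z12 : laurent (laurent R) := lift1 lX - lconst lX.

Lemma coef_lXM (f : laurent R) n : (lX * f) n = f (n - 1).
Proof. by rewrite coef_monoM mul1r. Qed.

Lemma bounded2_z12 : bounded2 z12.
Proof. by apply: bounded2B; [exact: bounded2_lift1|exact: bounded2_lconst]. Qed.

(** Multiplication by z1 - z2 on coefficient families that need not belong to
    R((z1, z2)), such as a product of two fields. *)
Definition zdiff (M : zmodType) (f : int -> int -> M) : int -> int -> M :=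
  fun a b => f (a - 1) b - f a (b - 1).

Lemma coef_z12M A a b : (z12 * A) a b = zdiff (fun a b => A a b) a b.
Proof.
rewrite /z12 mulrBl (coeflB (lift1 lX * A)) (coeflB ((lift1 lX * A) a)).
rewrite (coef_lconstM lX A a) coef_lXM; congr (_ - _).
rewrite coef_lift1M (@isum1 _ 1) ?coef_mono ?eqxx ?mul1r// => i /negPf i1.
by rewrite coef_mono i1 mul0r.
Qed.

(** The quotient A / (z1 - z2) expanded in nonnegative powers of z2 / z1. *)
Definition quot_coef A a b :=
  isum (fun s => if a < s then A s (a + b + 1 - s) else 0).

Lemma isupp_quot N A a n : order_ge2 N A ->
  isupp N (n - N + 1) (fun s => if a < s then A s (n - s) else 0).
Proof. by move=> AN s sN; rewrite (isupp_diag AN)//; case: ifP. Qed.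

Fact quot_subproof N A a : order_ge2 N A -> is_laurent (quot_coef A a).
Proof.
move=> [A1 A2]; exists N => b bN; apply: isum0 => s.
by case: ifP => // as_; rewrite A2//; lia.
Qed.

(** The expansion of A / (z1 - z2) is bounded below in z2 by construction. Its
    coefficient at z1^a z2^b sums A along an antidiagonal, over exponents of z1
    above a; for a small this is the whole antidiagonal, a coefficient of
    A(x, x) = 0. *)
Lemma divide_diagl0 N A : order_ge2 N A -> diagl A = 0 ->
  exists2 B, order_ge2 N B & A = z12 * B.
Proof.
move=> AN A0; have [A1 A2] := AN.
pose Bc a := Laurent (quot_subproof a AN).
have BcE a b : Bc a b = quot_coef A a b by [].
have BcN a : a < N -> Bc a = 0.
  move=> aN; apply: laurent_ext => b; rewrite BcE.
  transitivity (diagl A (a + b + 1)); last by rewrite A0.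
  rewrite coef_diagl; last by exists N.
  apply: eq_isum => s; case: ifP => // /negbT sa.
  by rewrite A1//; lia.
have Bl : is_laurent Bc by exists N.
exists (Laurent Bl).
  split=> [|a b bN]; first exact: BcN.
  rewrite -[LHS]/(quot_coef A a b); apply: isum0 => s.
  by case: ifP => // as_; rewrite A2//; lia.
apply: laurent_ext => a; apply: laurent_ext => b; rewrite coef_z12M.
rewrite /zdiff -[RHS]/(quot_coef A (a - 1) b - quot_coef A a (b - 1)) /quot_coef.
rewrite (_ : a - 1 + b + 1 = a + b); last by lia.
rewrite (_ : a + (b - 1) + 1 = a + b); last by lia.
rewrite -(isum_sub (isupp_quot _ AN) (isupp_quot _ AN)) (@isum1 _ a).
  rewrite ltxx subr0 ifT; last by lia.
  by congr (A _ _); lia.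
move=> s sa; have -> : (a - 1 < s) = (a < s) by lia.
by rewrite subrr.
Qed.

(** Each factor z1 - z2 raises the total degree by one. *)
Lemma z12_power_low k N A a b : order_ge2 N A -> a + b < N + N + k%:Z ->
  (z12 ^+ k * A) a b = 0.
Proof.
move=> [A1 A2]; elim: k a b => [|k IHk] a b ab.
  rewrite mul1r; have [?|?] := ltP a N; first by rewrite A1.
  by rewrite A2//; lia.
by rewrite exprS -mulrA coef_z12M /zdiff !IHk ?subrr//; lia.
Qed.

End DiagonalDivision.

Section ConvergentKernel.
Variable M : zmodType.
Implicit Types f g : int -> int -> M.

Definition below1 N f := forall a b, a < N -> f a b = 0.
Definition below2 N f := forall a b, b < N -> f a b = 0.

(** If (z1 - z2) h = 0 then h is constant along antidiagonals, and there it
    eventually vanishes. *)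
Lemma zdiff_inj1 N f g : below1 N f -> below1 N g -> zdiff f =2 zdiff g -> f =2 g.
Proof.
move=> fN gN fg; suff H (j : nat) a b :
    f a b - g a b = f (a - j%:Z) (b + j%:Z) - g (a - j%:Z) (b + j%:Z).
  move=> a b; apply/eqP; rewrite -subr_eq0 (H `|(a - N + 1)%R|%N).
  by rewrite fN ?gN ?subrr//; lia.
elim: j a b => [|j IHj] a b; first by congr (f _ _ - g _ _); lia.
rewrite (IHj a b).
have := fg (a - j%:Z) (b + j.+1%:Z); rewrite /zdiff.
rewrite (_ : a - j%:Z - 1 = a - j.+1%:Z); last by lia.
rewrite (_ : b + j.+1%:Z - 1 = b + j%:Z); last by lia.
move=> /(canRL (subrK _)) ->; set u := f _ _; set v := g _ _; set v' := g _ _.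
by rewrite [RHS]addrAC [v' - v - v']addrAC subrr sub0r addrC.
Qed.

Lemma zdiff_inj2 N f g : below2 N f -> below2 N g -> zdiff f =2 zdiff g -> f =2 g.
Proof.
move=> fN gN fg; suff H a b : g b a = f b a by move=> a b.
apply: (@zdiff_inj1 N (fun a b => g b a) (fun a b => f b a)) => {}a {}b.
- exact: gN.
- exact: fN.
- by rewrite /zdiff; apply: (can_inj opprK); rewrite !opprB; exact/esym/fg.
Qed.

Lemma zdiff_below1 k N f : below1 N f -> below1 N (iter k (@zdiff M) f).
Proof.
move=> fN; elim: k => //= k IHk a b aN.
by rewrite /zdiff !IHk ?subr0//; lia.
Qed.

Lemma zdiff_below2 k N f : below2 N f -> below2 N (iter k (@zdiff M) f).
Proof.
move=> fN; elim: k => //= k IHk a b aN.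
by rewrite /zdiff !IHk ?subr0//; lia.
Qed.

Lemma iter_zdiffB k f g a b :
  iter k (@zdiff M) (fun a b => f a b - g a b) a b =
  iter k (@zdiff M) f a b - iter k (@zdiff M) g a b.
Proof.
elim: k a b => //= k IHk a b.
by rewrite /zdiff !IHk !opprD !opprK addrACA.
Qed.

End ConvergentKernel.

(** * The series phi(x, z0) - x and its residues *)

Section Uniformizer.
Variables (R : comUnitRingType) (p : laurent R).
Hypotheses (QR : qalg R) (pu : p \is a GRing.unit).
Implicit Types (A B : laurent (laurent R)) (f g : laurent R).

Let QL : qalg (laurent R) := qalg_laurent QR.

(** phi(x, z0) - x, the image of z1 - z2; see [phi_shiftE]. *)
Definition phi_shift : laurent (laurent R) := tau p (z12 R).
Local Notation y := phi_shift.

Lemma phi_shiftE : y = expd (pder p) (lX R) - lconst (lX R).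
Proof.
have b1 := bounded2_lift1 (lX R); have bc := bounded2_lconst (lX R).
rewrite /phi_shift /z12 (tauB p QR b1 bc) tau_lconst//; congr (_ - _).
have bone : bounded2 (1 : laurent (laurent R)).
  by rewrite -(rmorph1 (@lconst _)); exact: bounded2_lconst.
rewrite -[lift1 _]mulr1 (tau_lift1M p QR _ bone) -(rmorph1 (@lconst _)) tau_lconst//.
by rewrite rmorph1 mulr1.
Qed.

Lemma tau_z12M A : bounded2 A -> tau p (z12 R * A) = y * tau p A.
Proof.
move=> bA; have b1 := bounded2M (bounded2_lift1 (lX R)) bA.
have bc := bounded2M (bounded2_lconst (lX R)) bA.
rewrite /z12 mulrBl (tauB p QR b1 bc) (tau_lift1M p QR _ bA) (tau_lconstM p QR _ bA).
by rewrite -mulrBl -phi_shiftE.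
Qed.

Lemma pder_lX : pder p (lX R) = p.
Proof. by rewrite /pder /scale_der /= deriv_mono mulr1 subrr mulr1. Qed.

Lemma order_ge_phi_shift : order_ge 1 y.
Proof.
have y0 : order_ge 0 y by exact: order_ge_tau.
move=> n n1; have [n0|n0] := ltP n 0; first exact: y0.
have -> : n = 0 by lia.
by rewrite phi_shiftE coeflB expd_0 coef_lconst eqxx subrr.
Qed.

Lemma phi_shift_1 : y 1 = p.
Proof.
rewrite phi_shiftE coeflB coef_lconst subr0 (coef_expd (pder p) (lX R) 1) /divpow.
by rewrite -[1`!]/1%N invr1 mul1r -[iter 1 _ _]/(pder p (lX R)) pder_lX.
Qed.

(** The series is z0 p(x) + O(z0^2), and p is invertible. *)
Lemma phi_shift_unit : y \is a GRing.unit /\ order_ge (- 1) (y^-1)%R.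
Proof. by apply: low_unit order_ge_phi_shift _; rewrite phi_shift_1. Qed.

(** If A(phi(x, z0), x) = 0 then A(x, x) = 0, so A = (z1 - z2) B with
    B(phi(x, z0), x) = 0. Iterating, A is divisible by every power of z1 - z2
    with quotients of the same bound, which forces each coefficient to vanish. *)
Lemma tau_inj A : bounded2 A -> tau p A = 0 -> A = 0.
Proof.
move=> [N AN] A0; have [yu _] := phi_shift_unit.
have Ak k : exists B, [/\ order_ge2 N B, tau p B = 0 & A = z12 R ^+ k * B].
  elim: k => [|k [B [BN B0 ->]]]; first by exists A; rewrite mul1r.
  have [|C CN BC] := @divide_diagl0 _ N B BN; first by rewrite -(tau_0 p) B0.
  exists C; split=> //; last by rewrite BC exprSr mulrA.
  apply: (mulrI yu); rewrite mulr0 -tau_z12M; last by exists N.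
  by rewrite -BC B0.
apply: laurent_ext => a; apply: laurent_ext => b.
have [B [BN _ ->]] := Ak `|(a + b - N - N + 1)%R|%N.
by apply: z12_power_low BN _; lia.
Qed.

(** Res_{z0} (phi - x)^{-k} phi^m (d phi / d z0), where p(phi) = d phi / d z0. *)
Definition residue_pow k m : laurent R :=
  ((y^-1) ^+ k * expd (pder p) (mono m 1) * expd (pder p) p) (-1).

Lemma residue_order_ge0 (F : laurent (laurent R)) : order_ge 0 F -> F (-1) = 0.
Proof. by move=> F0; rewrite F0. Qed.

Lemma deriv_phi_shift : deriv y = expd (pder p) p.
Proof.
rewrite phi_shiftE (raddfB (@deriv _)) /= deriv_lconst subr0 deriv_expd//.
by congr (expd _ _); exact: pder_lX.
Qed.

Let expd_pderM f g : expd (pder p) (f * g) = expd (pder p) f * expd (pder p) g.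
Proof. exact: (expdM QL (@pderM R p)). Qed.

(** Write phi^{m+1} = phi^m ((phi - x) + x). *)
Lemma residue_powS k m : residue_pow k.+1 (m + 1) = residue_pow k m + lX R * residue_pow k.+1 m.
Proof.
have [yu _] := phi_shift_unit.
have mS : mono (m + 1) 1 = mono 1 1 * mono m 1 :> laurent R.
  by rewrite monoM mulr1 addrC.
rewrite /residue_pow mS expd_pderM.
have -> : expd (pder p) (mono 1 1) = y + lconst (lX R) by rewrite phi_shiftE subrK.
set e := expd _ (mono m 1); set ep := expd _ p; rewrite exprS; set z := _ ^+ k.
have -> : y^-1 * z * ((y + lconst (lX R)) * e) * ep =
    (y^-1 * y) * (z * e * ep) + lconst (lX R) * (y^-1 * z * e * ep) by ring.
rewrite (mulVr yu) mul1r (coeflD (z * e * ep)).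
by rewrite (coef_lconstM (lX R) (y^-1 * z * e * ep)).
Qed.

Lemma residue_pow0 m : residue_pow 0 m = 0.
Proof.
apply: residue_order_ge0; apply: order_geM0; last exact: order_ge_expd.
by rewrite mul1r; exact: order_ge_expd.
Qed.

Lemma expd_one : expd (pder p) (mono 0 1) = 1.
Proof. exact: (expd1 QL (@pderM R p)). Qed.

(** The logarithmic derivative of a series of order one has residue 1. *)
Lemma residue_pow1_0 : residue_pow 1 0 = 1.
Proof.
have [yu y1] := phi_shift_unit; rewrite /residue_pow expr1 expd_one mulr1.
have := coeflM_low y1 (order_ge_expd (pder p) p).
rewrite addr0 => ->; rewrite expd_0 -phi_shift_1.
have := coeflM_low y1 order_ge_phi_shift; rewrite addNr => <-.
by rewrite mulVr// coefl1.
Qed.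

(** The differential is exact: up to the factor -1/(k+1) it is the derivative
    of (phi - x)^{-k-1}. *)
Lemma residue_powSS_0 k : residue_pow k.+2 0 = 0.
Proof.
have [yu y1] := phi_shift_unit; rewrite /residue_pow expd_one mulr1 -deriv_phi_shift.
apply: (mulrI (QL k)); rewrite mulr0 -lmul_nat.
rewrite -[LHS]opprK -coeflN (_ : - _ = deriv (y^-1 ^+ k.+1)) ?residue_deriv ?oppr0//.
rewrite derivXS derivV// exprSr exprSr expr2.
by set z := _ ^+ k; ring.
Qed.

End Uniformizer.

(** * The difference of two expansions as a residue *)

Section CommutatorResidue.
Variables (R : comUnitRingType) (p : laurent R).
Hypotheses (QR : qalg R) (pu : p \is a GRing.unit).
Implicit Types (A B E : laurent (laurent R)) (h : laurent R).

Let QL : qalg (laurent R) := qalg_laurent QR.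
Local Notation y := (phi_shift p).
Local Notation e := (expd (pder p)).

(** The expansions of (z1 - z2)^{-k} h(z2) in nonnegative powers of z2 / z1 and
    of z1 / z2. Their binomial coefficients are those produced by the residues
    [residue_pow], and Pascal's rule is [residue_powS]. *)
Definition expansion1 k h : int -> int -> R :=
  fun a b => if a < 0 then (residue_pow p k (- a - 1) * h) b else 0.

Definition expansion2 k h : int -> int -> R :=
  fun a b => if a < 0 then 0 else - (residue_pow p k (- a - 1) * h) b.

Lemma order_ge_residue_pow k (n : nat) : order_ge 0 (residue_pow p k n).
Proof.
elim: n k => [|n IHn] [|[|k]].
- by rewrite residue_pow0.
- by rewrite (residue_pow1_0 QR pu); exact: order_ge_mono.
- by rewrite (residue_powSS_0 QR pu).
- by rewrite residue_pow0.
- move=> i i0; rewrite (_ : n.+1%:Z = n%:Z + 1); last by lia.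
  by rewrite (residue_powS QR pu) coeflD coef_lXM !IHn ?addr0//; lia.
- move=> i i0; rewrite (_ : n.+1%:Z = n%:Z + 1); last by lia.
  by rewrite (residue_powS QR pu) coeflD coef_lXM !IHn ?addr0//; lia.
Qed.

Lemma residue_pow_diff k a b h :
  (residue_pow p k.+1 (- (a - 1) - 1) * h) b - (residue_pow p k.+1 (- a - 1) * h) (b - 1) =
  (residue_pow p k (- a - 1) * h) b.
Proof.
rewrite (_ : - (a - 1) - 1 = - a - 1 + 1); last by lia.
rewrite (residue_powS QR pu) mulrDl -mulrA.
rewrite (coeflD (residue_pow p k (- a - 1) * h)).
by rewrite (coef_lXM (residue_pow p k.+1 (- a - 1) * h)) addrK.
Qed.

Lemma below_expansion1 N k h : order_ge N h -> below2 N (expansion1 k h).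
Proof.
move=> hN a b bN; rewrite /expansion1; case: ifP => // a0.
have -> : - a - 1 = `|(- a - 1)%R|%N%:Z by lia.
have := order_geM (@order_ge_residue_pow k `|(- a - 1)%R|%N) hN.
by rewrite add0r => ->.
Qed.

Lemma below_expansion2 k h : below1 0 (expansion2 k h).
Proof. by move=> a b a0; rewrite /expansion2 a0. Qed.

Lemma zdiff_expansion1 k h a b :
  zdiff (expansion1 k.+1 h) a b = if k is 0 then lconst h a b else expansion1 k h a b.
Proof.
rewrite /zdiff /expansion1 coef_lconst; have [a0|a0] := ltP a 0.
  rewrite ifT; last by lia.
  rewrite residue_pow_diff; case: k => // ; rewrite residue_pow0 mul0r coefl0.
  by rewrite (_ : a == 0 = false)//; lia.
have [->|an0] := eqVneq a 0.
  rewrite subr0 [- (0 - 1) - 1](_ : _ = 0); last by lia.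
  by case: k => [|k]; rewrite ?(residue_pow1_0 QR pu) ?(residue_powSS_0 QR pu) ?mul1r ?mul0r.
rewrite ifF; last by lia.
by rewrite subr0; case: k.
Qed.

Lemma zdiff_expansion2 k h a b :
  zdiff (expansion2 k.+1 h) a b = if k is 0 then lconst h a b else expansion2 k h a b.
Proof.
rewrite /zdiff /expansion2 coef_lconst; have [a0|a0] := ltP a 0.
  rewrite ifT; last by lia.
  by rewrite subr0; case: k => //; rewrite (_ : a == 0 = false)//; lia.
have [->|an0] := eqVneq a 0.
  rewrite sub0r opprK.
  have := residue_pow_diff k 0 b h; rewrite [- (0 - 1) - 1](_ : _ = 0); last by lia.
  case: k => [|k].
    rewrite (residue_pow1_0 QR pu) mul1r residue_pow0 mul0r coefl0 => /eqP.
    by rewrite subr_eq0 eq_sym => /eqP.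
  by rewrite (residue_powSS_0 QR pu) mul0r coefl0 sub0r => <-; rewrite opprK.
rewrite ifF; last by lia.
rewrite opprK addrC -opprB residue_pow_diff.
by case: k => //; rewrite residue_pow0 mul0r oppr0.
Qed.

Lemma iter_zdiff_ext (M : zmodType) k (f g : int -> int -> M) :
  f =2 g -> iter k (@zdiff M) f =2 iter k (@zdiff M) g.
Proof. by move=> fg; elim: k => //= k IHk a b; rewrite /zdiff !IHk. Qed.

Lemma iter_zdiff_expansion1 k h a b :
  iter k.+1 (@zdiff R) (expansion1 k.+1 h) a b = lconst h a b.
Proof.
elim: k a b => [|k IHk] a b; first exact: zdiff_expansion1.
rewrite iterSr -IHk; apply: iter_zdiff_ext => c d.
exact: zdiff_expansion1.
Qed.

Lemma iter_zdiff_expansion2 k h a b :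
  iter k.+1 (@zdiff R) (expansion2 k.+1 h) a b = lconst h a b.
Proof.
elim: k a b => [|k IHk] a b; first exact: zdiff_expansion2.
rewrite iterSr -IHk; apply: iter_zdiff_ext => c d.
exact: zdiff_expansion2.
Qed.

Lemma expansion_diff k h a b :
  expansion1 k h a b - expansion2 k h a b = (residue_pow p k (- a - 1) * h) b.
Proof. by rewrite /expansion1 /expansion2; case: ifP; rewrite ?subr0// sub0r opprK. Qed.

(** The change of variables z1 = phi(z2, z0) in a residue. Here f and g are the
    two expansions of (z1 - z2)^{-k} A, and E is (phi - x)^{-k} A(phi, x). Splitting A = h(z2) + (z1 - z2) B with h = A(x, x)
    reduces k by one; the terms carrying h are matched by [expansion_diff]. *)
Lemma diff_residue k N (f g : int -> int -> R) A E :
    below2 N f -> below1 N g -> bounded2 A ->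
    iter k (@zdiff R) f =2 (fun a b => A a b) ->
    iter k (@zdiff R) g =2 (fun a b => A a b) ->
    y ^+ k * E = tau p A ->
  forall a b, f a b - g a b = (E * (e (mono (- a - 1) 1) * e p)) (- 1) b.
Proof.
elim: k N f g A E => [|k IHk] N f g A E fN gN bA fA gA EA a b.
  have -> : f a b = A a b by exact: fA.
  have -> : g a b = A a b by exact: gA.
  have E0 : order_ge 0 E by rewrite -[E]mul1r -[1](expr0 y) EA; exact: order_ge_tau.
  rewrite subrr residue_order_ge0 ?coefl0//; apply: order_geM0 => //.
  by apply: order_geM0; exact: order_ge_expd.
set h := diagl A; have [yu _] := phi_shift_unit QR pu.
have bh := bounded2_lconst h; have bC := bounded2B bA bh; have [K KC] := bC.
have [|B BK BC] := divide_diagl0 KC.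
  by rewrite (diaglB bA bh) diagl_lconst subrr.
have bB : bounded2 B by exists K.
have dzB : forall a b, zdiff (fun a b => B a b) a b = (A - lconst h) a b.
  by move=> c d; rewrite BC coef_z12M.
have [H hH] := lcoefP h.
pose f' a b := f a b - expansion1 k.+1 h a b.
pose g' a b := g a b - expansion2 k.+1 h a b.
pose E' := E - y^-1 ^+ k.+1 * lconst h.
have [L [LN LH LK L0]] : exists L, [/\ L <= N, L <= H, L <= K & L <= 0].
  by exists (- (`|N| + `|H| + `|K|)%N%:Z); split; lia.
have f'L : below2 L f'.
  by move=> c d dL; rewrite /f' fN ?(@below_expansion1 H k.+1 h hH c d) ?subr0//; lia.
have g'L : below1 L g'.
  by move=> c d cL; rewrite /g' gN ?(@below_expansion2 k.+1 h c d) ?subr0//; lia.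
have f'B : iter k (@zdiff R) f' =2 (fun a b => B a b).
  apply: (@zdiff_inj2 _ L); first exact: zdiff_below2.
    by move=> c d dL; apply: (BK.2 c d); lia.
  move=> c d; rewrite dzB (coeflB A) (coeflB (A c)) -(iter_zdiff_expansion1 k).
  have <- : iter k.+1 (@zdiff R) f c d = A c d by exact: fA.
  exact: (iter_zdiffB k.+1 f).
have g'B : iter k (@zdiff R) g' =2 (fun a b => B a b).
  apply: (@zdiff_inj1 _ L); first exact: zdiff_below1.
    by move=> c d cL; rewrite (BK.1 c)//; lia.
  move=> c d; rewrite dzB (coeflB A) (coeflB (A c)) -(iter_zdiff_expansion2 k).
  have <- : iter k.+1 (@zdiff R) g c d = A c d by exact: gA.
  exact: (iter_zdiffB k.+1 g).
have E'B : y ^+ k * E' = tau p B.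
  apply: (mulrI yu); rewrite -tau_z12M// -BC (tauB p QR bA bh) tau_lconst//.
  rewrite mulrA -exprS /E' mulrBr EA mulrA -exprMn mulrV// expr1n mul1r.
  by [].
have := IHk _ _ _ _ _ f'L g'L bB f'B g'B E'B a b.
move=> IH; set em := e (mono _ 1); set ep := e p.
have -> : E * (em * ep) =
    E' * (em * ep) + lconst h * (y^-1 ^+ k.+1 * em * ep) by rewrite /E'; ring.
rewrite (coeflD (E' * (em * ep))) (coef_lconstM h (y^-1 ^+ k.+1 * em * ep)).
rewrite (coeflD ((E' * (em * ep)) (-1))) -IH.
have -> : (h * (y^-1 ^+ k.+1 * em * ep) (-1)) b =
    expansion1 k.+1 h a b - expansion2 k.+1 h a b by rewrite expansion_diff mulrC.
by rewrite /f' /g'; ring.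
Qed.

End CommutatorResidue.

(** * Weak commutativity *)

Section WeakCommutativity.
Variables (R : comUnitRingType) (p : laurent R).
Hypotheses (QR : qalg R) (pu : p \is a GRing.unit).
Implicit Types (A B E F : laurent (laurent R)).

Let QL : qalg (laurent R) := qalg_laurent QR.
Local Notation y := (phi_shift p).

(** The flip exchanges phi(x, z0) and x. *)
Lemma tau_flip_z12 : expdL (pder p) (sgnl y) = - y.
Proof.
rewrite -[LHS]/(tau_flip p (z12 R)) -(@tau_swapped _ p QR (- z12 R)).
- exact: (tauN p QR (@bounded2_z12 R)).
- exact: bounded2N (@bounded2_z12 R).
- exact: bounded2_z12.
move=> a b; rewrite /z12 (coeflN (lift1 (lX R) - lconst (lX R))) coeflN.
rewrite !(coeflB (lift1 (lX R)) (lconst (lX R))).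
rewrite (coeflB (lift1 (lX R) a)) (coeflB (lift1 (lX R) b)).
rewrite !coef_lift1 !(coef_lconst (lX R)).
by case: (a == 0); case: (b == 0); rewrite ?coefl0 ?coef_mono opprB.
Qed.

(** When E is the skew-symmetric transform of F, flipping the relation between
    F and B gives (x - phi)^k E = B(x, phi). Hence A and (-1)^k B(z2, z1) have
    the same image under the injective substitution. *)
Lemma weak_commutativity k A B Bt E F :
    bounded2 A -> bounded2 B -> bounded2 Bt -> swapped Bt B ->
    y ^+ k * E = tau p A -> y ^+ k * F = tau p B ->
    E = expdL (pder p) (sgnl F) ->
  A = (-1) ^+ k * Bt.
Proof.
move=> bA bB bBt Bs EA FB EF.
have tBt : tau p Bt = (- y) ^+ k * E.
  have expdLM' := expdLM QL (@pderM R p).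
  have yk : expdL (pder p) (sgnl (y ^+ k)) = (- y) ^+ k.
    elim: k {EA FB} => [|k IHk].
      rewrite !expr0 -[X in sgnl X]/(lconst 1) sgnl_lconst expdL_lconst.
      exact: (expd1 QL (@pderM R p)).
    by rewrite !exprS (sgnlM y) (expdLM' (sgnl y)) IHk tau_flip_z12.
  rewrite (tau_swapped p QR bBt bB Bs) /tau_flip -FB EF (sgnlM (y ^+ k) F).
  by rewrite (expdLM' (sgnl (y ^+ k)) (sgnl F)) yk.
have bkB : bounded2 ((-1) ^+ k * Bt).
  by rewrite -signr_odd mulr_sign; case: odd => //; exact: bounded2N.
apply/eqP; rewrite -subr_eq0; apply/eqP; apply: (tau_inj QR pu).
  exact: bounded2B.
rewrite (tauB p QR bA bkB).
have -> : tau p ((-1) ^+ k * Bt) = (-1) ^+ k * tau p Bt.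
  by rewrite -signr_odd !mulr_sign; case: odd => //; exact: tauN.
by rewrite tBt mulrA -exprMn mulN1r opprK EA subrr.
Qed.

End WeakCommutativity.

(** * Infinite-order differential operators that vanish *)

Section Uniqueness.
Variables (R : comUnitRingType).
Hypothesis QR : qalg R.

Lemma intr_unit (n : int) : n != 0 -> (n%:~R : R) \is a GRing.unit.
Proof.
case: n => [[//|n]|n] _; first exact: QR.
by rewrite NegzE mulrNz unitrN; exact: QR.
Qed.

Definition shifted_power (d : int) j (n : int) : int := \prod_(0 <= i < j) (n + i%:Z * d).

(** The factors of [shifted_power d j n] make it a polynomial in n of degree
    exactly j, and a polynomial over a rational algebra that vanishes at all
    integers is zero. *)
Lemma shifted_power_indep (d : int) (J : nat) (h : nat -> R) :
    (forall n : int, \sum_(j < J) h j * (shifted_power d j n)%:~R = 0) ->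
  forall j, (j < J)%N -> h j = 0.
Proof.
pose q j : {poly R} := \prod_(0 <= i < j) ('X - (- (i%:Z * d)%:~R)%:P).
have q_mon j : q j \is monic by apply: monic_prod => i _; exact: monicXsubC.
have q_size j : size (q j) = j.+1 by rewrite size_prod_XsubC /index_iota size_iota subn0.
have qE j (n : int) : (q j).[n%:~R] = (shifted_power d j n)%:~R.
  rewrite horner_prod rmorph_prod; apply: eq_bigr => i _.
  by rewrite hornerXsubC opprK rmorphD.
elim: J => // J IHJ hJ.
pose Q := \sum_(j < J.+1) h j *: q j.
have sQ : (size Q <= J.+1)%N.
  apply: leq_trans (size_sum _ _ _) _; apply/bigmax_leqP => i _.
  by apply: leq_trans (size_scale_leq _ _) _; rewrite q_size.
have Q0 : Q = 0.
  apply/eqP/negPn/negP => /(max_ring_poly_roots (rs := [seq n%:R | n <- iota 0 J.+1])) H.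
  have : (J.+1 < size Q)%N; last by rewrite ltnNge sQ.
  rewrite -[X in (X < _)%N](size_iota 0 J.+1) -(size_map (fun n : nat => n%:R : R)).
  apply: H.
    apply/allP => x /mapP [n _ ->]; rewrite /root horner_sum -[X in _ == X](hJ n).
    by apply/eqP/eq_bigr => j _; rewrite hornerZ -qE.
  elim: J.+1 0%N => //= k IHk m; rewrite IHk andbT.
  apply/allP => x /mapP [n]; rewrite mem_iota => /andP [mn _] ->.
  rewrite /diff_roots mulrC eqxx /=.
  rewrite -(natrB _ (ltnW mn)).
  by have := QR (n - m).-1; rewrite prednK// subn_gt0.
have hJ0 : h J = 0.
  have := congr1 (fun P : {poly R} => P`_J) Q0.
  rewrite coef0 coef_sum big_ord_recr big1 /= ?add0r => [|i _].
    rewrite coefZ; have /monicP := q_mon J.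
    by rewrite /lead_coef q_size /= => ->; rewrite mulr1.
  by rewrite coefZ nth_default ?mulr0// q_size.
move=> j; rewrite ltnS leq_eqVlt => /predU1P [->//|]; apply: IHJ => n.
by have := hJ n; rewrite big_ord_recr /= hJ0 mul0r addr0.
Qed.

Variables (p : laurent R) (r : int).
Hypotheses (pr : order_ge r p) (pru : p r \is a GRing.unit).
Implicit Types f g : laurent R.

Let QL : qalg (laurent R) := qalg_laurent QR.

(** D sends a x^n + ... to n a p_r x^{n+r-1} + ..., where r is the order of p. *)
Lemma pder_low n g : order_ge n g ->
  order_ge (n + (r - 1)) (pder p g) /\ pder p g (n + (r - 1)) = p r * (n%:~R * g n).
Proof.
move=> gn; have dn := order_ge_deriv gn.
have -> : n + (r - 1) = r + (n - 1) by lia.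
split; first exact: order_geM.
by rewrite /pder /scale_der coeflM_low// coef_deriv subrK.
Qed.

Lemma iter_pder_low n g j : order_ge n g ->
  order_ge (n + j%:Z * (r - 1)) (iter j (pder p) g) /\
  iter j (pder p) g (n + j%:Z * (r - 1)) =
    p r ^+ j * ((shifted_power (r - 1) j n)%:~R * g n).
Proof.
move=> gn; elim: j => [|j [IH1 IH2]].
  by rewrite /shifted_power big_geq// mul0r addr0 !mul1r.
have [] := pder_low IH1.
have -> : n + j%:Z * (r - 1) + (r - 1) = n + j.+1%:Z * (r - 1) by lia.
move=> H1 H2; split=> //; rewrite [LHS]H2 IH2 exprS /shifted_power big_nat_recr//=.
by rewrite intrM; ring.
Qed.

Lemma divpow_coef j g n : divpow (pder p) j g n = (j`!%:R)^-1 * iter j (pder p) g n.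
Proof.
rewrite /divpow -(rmorph_nat (@lconst R)) -rmorphV ?fact_unit//.
exact: coef_lconstM.
Qed.

Lemma divpow_low n g j : order_ge n g ->
  order_ge (n + j%:Z * (r - 1)) (divpow (pder p) j g) /\
  divpow (pder p) j g (n + j%:Z * (r - 1)) =
    (j`!%:R)^-1 * (p r ^+ j * ((shifted_power (r - 1) j n)%:~R * g n)).
Proof.
move=> gn; have [H1 H2] := iter_pder_low j gn.
by split=> [k kn|]; rewrite divpow_coef; [rewrite H1// mulr0 | rewrite H2].
Qed.

(** An exponent n for which no iterate of D kills the leading term of x^n: the
    numbers n + i (r - 1) stay positive if r is positive and negative
    otherwise. *)
Definition good_exponent : int := if 1 <= r then 1 else -1.

Lemma shifted_power_good j : shifted_power (r - 1) j good_exponent != 0.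
Proof.
elim: j => [|j IHj]; first by rewrite /shifted_power big_geq.
rewrite /shifted_power big_nat_recr//= mulf_neq0// /good_exponent.
by case: ifP => r1; nia.
Qed.

Let term m j := divpow (pder p) j (p * mono m 1).

Lemma order_ge_pmono m : order_ge (m + r) (p * mono m 1) /\ (p * mono m 1) (m + r) = p r.
Proof.
rewrite addrC; split; first by apply: order_geM => //; exact: order_ge_mono.
by rewrite (coeflM_low pr (@order_ge_mono _ m 1)) coef_mono eqxx mulr1.
Qed.

(** Convergence on one monomial with a good exponent forces the order of f_j
    plus j (r - 1) to tend to infinity. So for each s only finitely many f_j have
    a nonzero coefficient g_j at x^{s - j(r-1)}. For the least s at which some
    g_j is nonzero, the leading coefficient of the operator on x^n is a linear
    combination of the g_j with coefficients polynomial in n of distinct degrees;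
    it vanishes for every n, so all g_j are zero. *)
Lemma formal_operator_unique (f : nat -> laurent R) :
    (forall m N : int, exists J : nat, forall J', (J <= J')%N ->
       forall n, n < N -> \sum_(0 <= j < J') (f j * term m j) n = 0) ->
  forall j, f j = 0.
Proof.
move=> fT.
(* A summand is a difference of partial sums. Divide it by the factor
   D^j(p x^m) / j!, whose lowest coefficient is a unit for the good exponent. *)
have tail (N : int) : exists J : nat, forall j, (J <= j)%N ->
    order_ge (N - j%:Z * (r - 1)) (f j).
  have [J HJ] := fT (good_exponent - r) (N + good_exponent); exists J => j Jj.
  have fTj : order_ge (N + good_exponent) (f j * term (good_exponent - r) j).
    move=> n nN; have := HJ j.+1 (leqW Jj) n nN.
    by rewrite big_nat_recr//= HJ// add0r.
  have [pm pmr] := order_ge_pmono (good_exponent - r); rewrite subrK in pm pmr.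
  have [T1 T2] := divpow_low j pm.
  have Tu : term (good_exponent - r) j (good_exponent + j%:Z * (r - 1)) \is a GRing.unit.
    rewrite /term T2 pmr !unitrM unitrV fact_unit// unitrX//=.
    by rewrite intr_unit ?shifted_power_good.
  have [Tu' Tl] := low_unit T1 Tu.
  rewrite -[f j](mulrK Tu').
  have := order_geM fTj Tl; apply: order_geW; lia.
have [S fS] : exists S : int, forall j, order_ge (S - j%:Z * (r - 1)) (f j).
  have [J HJ] := tail 0.
  have [S HS] : exists S : int, forall j, (j < J)%N -> order_ge (S - j%:Z * (r - 1)) (f j).
    elim: {HJ} J => [|J [S IH]]; first by exists 0.
    have [a fa] := lcoefP (f J).
    exists (- (`|S| + `|(a + J%:Z * (r - 1))%R|)%N%:Z) => j.
    rewrite ltnS leq_eqVlt => /predU1P [->|jJ]; first by apply: order_geW fa; lia.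
    by apply: order_geW (IH j jJ); lia.
  exists (- `|S|%N%:Z) => j; have [/HS|/HJ] := ltnP j J; apply: order_geW; lia.
(* Each step gains one order for all f_j simultaneously. *)
suff fSk (k : nat) j : order_ge (S + k%:Z - j%:Z * (r - 1)) (f j).
  move=> j; apply: order_ge_eq0 => a.
  by apply: order_geW (fSk `|(a - S + j%:Z * (r - 1))%R|%N j); lia.
elim: k j => [|k IHk] j; first by rewrite addr0; exact: fS.
set s := S + k%:Z in IHk *.
suff fs0 : f j (s - j%:Z * (r - 1)) = 0.
  move=> n; rewrite /= => nn; have [->//|ns] := eqVneq n (s - j%:Z * (r - 1)).
  by apply: (IHk j); lia.
have [J HJ] := tail (s + 1).
have [Jj|jJ] := leqP J j; first by apply: (HJ j Jj); lia.
suff : f j (s - j%:Z * (r - 1)) * ((j`!%:R)^-1 * p r ^+ j.+1) = 0.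
  have u : (j`!%:R : R)^-1 * p r ^+ j.+1 \is a GRing.unit.
    by rewrite unitrM unitrV fact_unit// unitrX.
  by move=> /(congr1 ( *%R^~ (((j`!%:R)^-1 * p r ^+ j.+1)^-1))); rewrite mulrK// mul0r.
move: j jJ.
apply: (@shifted_power_indep (r - 1) J
  (fun j => f j (s - j%:Z * (r - 1)) * ((j`!%:R)^-1 * p r ^+ j.+1))) => n.
(* Since p x^{n-r} starts at x^n, the coefficient of x^{n+s} sees exactly the
   leading terms. *)
have [J1 HJ1] := fT (n - r) (n + s + 1).
have [pm pmr] := order_ge_pmono (n - r); rewrite subrK in pm pmr.
have := HJ1 (maxn J J1) (leq_maxr _ _) (n + s).
rewrite (@big_cat_nat _ _ _ J)//= ?leq_maxl//.
rewrite [X in _ + X = _](_ : _ = 0) ?addr0; last first.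
  rewrite big_nat_cond big1// => j /andP [/andP [Jj _] _].
  have [T1 _] := divpow_low j pm.
  by apply: (order_geM (HJ j Jj) T1); lia.
rewrite big_mkord => E; rewrite -[RHS]E; last by lia.
apply: eq_bigr => j _; have [T1 T2] := divpow_low j pm.
have -> : n + s = s - j%:Z * (r - 1) + (n + j%:Z * (r - 1)) by lia.
by rewrite (coeflM_low (IHk j) T1) T2 pmr exprSr; ring.
Qed.

End Uniqueness.

(** * The square-zero extension of the field by the module *)

Section SquareZero.
Variables (K : fieldType) (W : lmodType K).

(** Working over the commutative ring K + W with W W = 0 makes W-valued series
    elements of the same ring as scalar series, and turns the action of K((x))
    on W((x)) into multiplication. *)
Definition sqz : Type := (K * W)%type.
HB.instance Definition _ := GRing.Zmodule.on sqz.

Definition sqz_one : sqz := (1, 0).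
Definition sqz_mul (x y : sqz) : sqz := (x.1 * y.1, x.1 *: y.2 + y.1 *: x.2).

Fact sqz_mulA : associative sqz_mul.
Proof.
move=> [a u] [b v] [c w]; congr pair; rewrite /= ?mulrA//.
by rewrite !scalerDr !scalerA addrA [c * a]mulrC [c * b]mulrC.
Qed.
Fact sqz_mulC : commutative sqz_mul.
Proof. by move=> [a u] [b v]; congr pair; rewrite /= 1?mulrC 1?addrC. Qed.
Fact sqz_mul1 : left_id sqz_one sqz_mul.
Proof. by move=> [a u]; congr pair; rewrite /= ?mul1r// scale1r scaler0 addr0. Qed.
Fact sqz_mulDl : left_distributive sqz_mul +%R.
Proof.
move=> [a u] [b v] [c w]; congr pair; rewrite /= ?mulrDl//.
by rewrite scalerDl scalerDr addrACA.
Qed.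
Fact sqz_one_neq0 : sqz_one != 0.
Proof. by apply/eqP => -[/eqP]; rewrite oner_eq0. Qed.

HB.instance Definition _ := GRing.Zmodule_isComNzRing.Build sqz
  sqz_mulA sqz_mulC sqz_mul1 sqz_mulDl sqz_one_neq0.
HB.instance Definition _ := GRing.ComNzRing_hasMulInverse.Build sqz
  (@cmulVr sqz) (@cunitPl sqz) (@cinv_out sqz).

Definition sqK (c : K) : sqz := (c, 0).
Definition sqW (w : W) : sqz := (0, w).

Fact sqK_is_zmod_morphism : zmod_morphism sqK.
Proof. by move=> a b; congr pair; rewrite /= subr0. Qed.
HB.instance Definition _ := GRing.isZmodMorphism.Build K sqz sqK sqK_is_zmod_morphism.
Fact sqK_is_monoid_morphism : monoid_morphism sqK.
Proof. by split=> // a b; congr pair; rewrite /= !scaler0 addr0. Qed.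
HB.instance Definition _ := GRing.isMonoidMorphism.Build K sqz sqK sqK_is_monoid_morphism.
Fact sqW_is_zmod_morphism : zmod_morphism sqW.
Proof. by move=> a b; congr pair; rewrite /= subr0. Qed.
HB.instance Definition _ := GRing.isZmodMorphism.Build W sqz sqW sqW_is_zmod_morphism.

Lemma sqKW c w : sqK c * sqW w = sqW (c *: w).
Proof. by congr pair; rewrite /= ?mulr0// scale0r addr0. Qed.

Lemma sqW_inj : injective sqW. Proof. by move=> v w []. Qed.

Lemma sqK_unit c : c != 0 -> sqK c \is a GRing.unit.
Proof. by move=> c0; rewrite rmorph_unit ?unitfE. Qed.

Hypothesis K0 : forall n, n.+1%:R != 0 :> K.

Lemma sqz_qalg : qalg sqz.
Proof. by move=> n; rewrite -(rmorph_nat sqK) sqK_unit. Qed.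

End SquareZero.

(** * Embedding of scalar-valued and module-valued series *)

Definition mkl (M : nmodType) (f : int -> M) : laurent M :=
  if pselect (is_laurent f) is left pf then Laurent pf
  else Laurent (ex_intro _ 0 (fun _ _ => erefl) : is_laurent (fun=> 0 : M)).

Lemma coef_mkl (M : nmodType) (f : int -> M) : is_laurent f -> mkl f =1 f.
Proof. by move=> lf n; rewrite /mkl; case: pselect. Qed.

Lemma is_laurent_morph (M N : zmodType) (h : {additive M -> N}) (f : int -> M) :
  is_laurent f -> is_laurent (fun n => h (f n)).
Proof. by move=> [a fa]; exists a => n na; rewrite fa// raddf0. Qed.

Section Embedding.
Variables (K : fieldType) (W : lmodType K).
Hypothesis K0 : forall n, n.+1%:R != 0 :> K.
Local Notation S := (sqz W).
Implicit Types (p q : int -> K) (f : int -> W) (F : int -> int -> W).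

Let QS : qalg S := sqz_qalg W K0.

Definition serK p : laurent S := mkl (fun n => sqK W (p n)).
Definition serW f : laurent S := mkl (fun n => sqW (f n)).
Definition serK2 (A : int -> int -> K) : laurent (laurent S) := mkl (fun m => serK (A m)).
Definition serW2 F : laurent (laurent S) := mkl (fun m => serW (F m)).

Lemma coef_serK p : is_laurent p -> forall n, serK p n = sqK W (p n).
Proof. by move=> lp n; rewrite coef_mkl//; exact: (is_laurent_morph (@sqK K W)). Qed.

Lemma coef_serW f : is_laurent f -> forall n, serW f n = sqW (f n).
Proof. by move=> lf n; rewrite coef_mkl//; exact: (is_laurent_morph (@sqW K W)). Qed.

(** Membership in M((x))((z)), the outer variable being the first index. *)
Definition iter_laurent (M : zmodType) (F : int -> int -> M) : Prop :=
  is_laurent F /\ forall m, is_laurent (F m).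

Lemma coef_serK2 A : iter_laurent A -> forall m n, serK2 A m n = sqK W (A m n).
Proof.
move=> [[N AN] lA] m n; rewrite coef_mkl ?coef_serK//.
exists N => i iN; apply: laurent_ext => j.
by rewrite coef_serK// AN// raddf0.
Qed.

Lemma coef_serW2 F : iter_laurent F -> forall m n, serW2 F m n = sqW (F m n).
Proof.
move=> [[N FN] lF] m n; rewrite coef_mkl ?coef_serW//.
exists N => i iN; apply: laurent_ext => j.
by rewrite coef_serW// FN// raddf0.
Qed.

Lemma is_laurent_smul (M : lmodType K) p (f : int -> M) :
  is_laurent p -> is_laurent f -> is_laurent (smul p f).
Proof.
move=> [a pa] [b fb]; exists (a + b) => n nab; apply: isum0 => i.
have [?|?] := ltP i a; first by rewrite pa// scale0r.
by rewrite fb ?scaler0//; lia.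
Qed.

Lemma isupp_smul (M : lmodType K) a b p (f : int -> M) n : order_ge a p -> order_ge b f ->
  isupp a (n - b + 1) (fun i => p i *: f (n - i)).
Proof.
move=> pa fb i ai; have [?|?] := ltP i a; first by rewrite pa// scale0r.
by rewrite fb ?scaler0//; lia.
Qed.

Arguments isupp_smul {M a b p f} n pa fb : rename.

Lemma serW_smul p f : is_laurent p -> is_laurent f ->
  serW (smul p f) = serK p * serW f.
Proof.
move=> lp lf; apply: laurent_ext => n; rewrite coef_serW; last exact: is_laurent_smul.
have [[a pa] [b fb]] := (lp, lf); rewrite coeflM.
rewrite [LHS](@isum_morph _ _ (@sqW K W) _ _ _ _ _ (isupp_smul n pa fb)).
- by apply: eq_isum => i; rewrite coef_serK// coef_serW// sqKW.
- exact: raddf0.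
- exact: raddfD.
Qed.

Lemma serK_smul p q : is_laurent p -> is_laurent q ->
  serK (smul p (q : int -> K^o)) = serK p * serK q.
Proof.
move=> lp lq; apply: laurent_ext => n.
rewrite coef_serK; last exact: (@is_laurent_smul K^o).
have [[a pa] [b fb]] := (lp, lq); rewrite coeflM.
rewrite [LHS](@isum_morph _ _ (@sqK K W) _ _ _ _ _ (@isupp_smul K^o _ _ _ _ n pa fb)).
- by apply: eq_isum => i; rewrite !coef_serK// -rmorphM.
- exact: raddf0.
- exact: raddfD.
Qed.

Lemma is_laurent_fderiv (M : lmodType K) (f : int -> M) : is_laurent f -> is_laurent (fderiv f).
Proof.
by move=> [a fa]; exists (a - 1) => n na; rewrite /fderiv fa ?scaler0//; lia.
Qed.

Lemma is_laurent_pD (M : lmodType K) p (f : int -> M) : is_laurent p -> is_laurent f ->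
  is_laurent (pD p f).
Proof. by move=> lp lf; apply: is_laurent_smul => //; exact: is_laurent_fderiv. Qed.

Lemma is_laurent_iter_pD (M : lmodType K) p j (f : int -> M) : is_laurent p -> is_laurent f ->
  is_laurent (iter j (pD p) f).
Proof. by move=> lp lf; elim: j => //= j; exact: is_laurent_pD. Qed.

Lemma is_laurent_pDdiv (M : lmodType K) p j (f : int -> M) : is_laurent p -> is_laurent f ->
  is_laurent (pDdiv p j f).
Proof.
move=> lp lf; have [a fa] := is_laurent_iter_pD j lp lf.
by exists a => n na; rewrite /pDdiv fa// scaler0.
Qed.

Lemma sqK_int (z : int) : sqK W z%:~R = z%:~R.
Proof. exact: rmorph_int. Qed.

Lemma serK_pD p q : is_laurent p -> is_laurent q ->
  serK (pD p (q : int -> K^o)) = pder (serK p) (serK q).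
Proof.
move=> lp lq; rewrite [LHS]serK_smul//; last exact: (@is_laurent_fderiv K^o).
congr (_ * _); apply: laurent_ext => n.
rewrite coef_serK; last exact: (@is_laurent_fderiv K^o).
by rewrite coef_deriv coef_serK// -sqK_int -rmorphM.
Qed.

Lemma serK_pDdiv p j q : is_laurent p -> is_laurent q ->
  serK (pDdiv p j (q : int -> K^o)) = divpow (pder (serK p)) j (serK q).
Proof.
move=> lp lq; apply: laurent_ext => n.
rewrite coef_serK; last exact: (@is_laurent_pDdiv K^o).
rewrite (divpow_coef QS) -(rmorph_nat (@sqK K W)) -rmorphV; last first.
  by rewrite unitfE; case: j`! (fact_gt0 j).
have <- : serK (iter j (pD p) (q : int -> K^o)) = iter j (pder (serK p)) (serK q).
  elim: j => //= j <-; rewrite serK_pD//; exact: (@is_laurent_iter_pD K^o).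
rewrite coef_serK; last exact: (@is_laurent_iter_pD K^o).
by rewrite -rmorphM.
Qed.

Lemma is_laurent_varx : is_laurent (varx K).
Proof. by exists 1 => n n1; rewrite /varx lt_eqF. Qed.

Lemma serK_varx : serK (varx K) = lX S.
Proof.
apply: laurent_ext => n; rewrite (coef_serK is_laurent_varx) /varx coef_mono.
by case: eqP => _; rewrite ?rmorph1 ?rmorph0.
Qed.

Lemma iter_laurent_phi p : is_laurent p -> iter_laurent (phi p).
Proof.
move=> lp; split=> [|[j|j]]; first by exists 0; case.
  exact: (@is_laurent_pDdiv K^o _ _ _ lp is_laurent_varx).
by exists 0.
Qed.

Lemma iter_laurent_phi_sub p : is_laurent p -> iter_laurent (phi_sub p).
Proof.
move=> lp; have [[N pN] lphi] := iter_laurent_phi lp; split.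
  exists (Num.min N 0) => m mN; apply/funext => n; rewrite /phi_sub pN; last by lia.
  by rewrite /const_series lt_eqF ?subrr//; lia.
move=> m; have [a pa] := lphi m; exists (Num.min a 1) => n na.
rewrite /phi_sub pa /const_series; last by lia.
by case: ifP => _; rewrite ?subrr// /varx lt_eqF ?subrr//; lia.
Qed.

Lemma serK2_phi_sub p : is_laurent p -> serK2 (phi_sub p) = phi_shift (serK p).
Proof.
move=> lp; rewrite (phi_shiftE _ QS); apply: laurent_ext => m; apply: laurent_ext => n.
rewrite (coef_serK2 (iter_laurent_phi_sub lp)) (coeflB (expd _ _)).
rewrite (coeflB (expd (pder (serK p)) (lX S) m)) /phi_sub raddfB /=; congr (_ - _).
  case: m => m; last by rewrite order_ge_expd// raddf0.
  rewrite coef_expd -serK_varx -(serK_pDdiv _ lp is_laurent_varx) coef_serK//.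
  exact: (@is_laurent_pDdiv K^o _ _ _ lp is_laurent_varx).
rewrite /const_series coef_lconst; case: eqP => _; last by rewrite raddf0.
by rewrite -serK_varx coef_serK//; exact: is_laurent_varx.
Qed.

(** The identity p(z1) delta(z2 / z1) = p(z2) delta(z2 / z1). *)
Lemma pbar_deltaE p a b : pbar_delta p a b = p (a + b + 1).
Proof.
rewrite -[LHS]/(isum _) (@isum1 _ (a + b)) /delta21.
  by rewrite (_ : a - (a + b) + b == 0) ?mulr1//; lia.
by move=> i iab; rewrite (_ : (a - i + b == 0) = false) ?mulr0//; lia.
Qed.

Lemma is_laurent_pbar_delta p a : is_laurent p -> is_laurent (pbar_delta p a).
Proof.
by move=> [N pN]; exists (N - a - 1) => n nN; rewrite pbar_deltaE pN//; lia.
Qed.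

Lemma serK_pbar_delta p a : is_laurent p ->
  serK (pbar_delta p a) = serK p * mono (- a - 1) 1.
Proof.
move=> lp; apply: laurent_ext => n; rewrite mulrC coef_monoM mul1r !coef_serK//.
  by rewrite pbar_deltaE; congr (sqK _ (p _)); lia.
exact: is_laurent_pbar_delta.
Qed.

(** At z1^a the delta distribution contributes p(x) x^{-a-1}. *)
Lemma serW_comm_term (V : lmodType K) p (YW : V -> W -> int -> W) c j w a :
  is_laurent p -> is_laurent (YW c w) ->
  serW (comm_term p YW c j w a) =
    divpow (pder (serK p)) j (serK p * mono (- a - 1) 1) * serW (YW c w).
Proof.
move=> lp lY; have lb := is_laurent_pbar_delta a lp.
rewrite -serK_pbar_delta// -serK_pDdiv// -serW_smul//.
exact: (@is_laurent_pDdiv K^o).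
Qed.

Lemma isum_eval (G : int -> int -> W) a b k : isupp a b G ->
  isum G k = isum (fun i => G i k).
Proof. exact: (@isum_morph _ _ (fun g : int -> W => g k)). Qed.

Lemma is_laurent_isum (G : int -> int -> W) a b : isupp a b G ->
  (forall i, is_laurent (G i)) -> is_laurent (isum G).
Proof.
move=> Gab lG; rewrite (isumE Gab); elim/big_ind: _ => //.
  by exists 0.
move=> f g [c fc] [d gd]; exists (Num.min c d) => n ncd.
by rewrite -[LHS]/(f n + g n) fc ?gd ?addr0//; lia.
Qed.

Lemma serK2E A m : iter_laurent A -> serK2 A m = serK (A m).
Proof.
by move=> iA; apply: laurent_ext => n; rewrite (coef_serK2 iA) coef_serK//; case: iA.
Qed.

Lemma serW2E F m : iter_laurent F -> serW2 F m = serW (F m).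
Proof.
by move=> iF; apply: laurent_ext => n; rewrite (coef_serW2 iF) coef_serW//; case: iF.
Qed.

Lemma smul0l (M : lmodType K) (f : int -> M) : smul 0 f = 0.
Proof. by apply/funext => n; apply: isum0 => i; rewrite -[X in X *: _]/0 scale0r. Qed.

Lemma smul0r (M : lmodType K) p : smul p (0 : int -> M) = 0.
Proof. by apply/funext => n; apply: isum0 => i; exact: scaler0. Qed.

Lemma isupp_smul2 a b (A : int -> int -> K) F n : order_ge a A -> order_ge b F ->
  isupp a (n - b + 1) (fun i => smul (A i) (F (n - i))).
Proof.
move=> Aa Fb i ai; have [?|?] := ltP i a; first by rewrite Aa// smul0l.
by rewrite Fb ?smul0r//; lia.
Qed.

Lemma iter_laurent_smul2 (A : int -> int -> K) F : iter_laurent A -> iter_laurent F ->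
  iter_laurent (smul2 A F).
Proof.
move=> [[a Aa] lA] [[b Fb] lF]; split=> [|n].
  exists (a + b) => n nab; apply: isum0 => i.
  by rewrite (isupp_smul2 (n := n) Aa Fb)//; lia.
apply: is_laurent_isum (isupp_smul2 (n := n) Aa Fb) _ => i.
exact: is_laurent_smul.
Qed.

Lemma serW2_smul2 (A : int -> int -> K) F : iter_laurent A -> iter_laurent F ->
  serW2 (smul2 A F) = serK2 A * serW2 F.
Proof.
move=> iA iF; apply: laurent_ext => n; apply: laurent_ext => k.
rewrite coef_serW2; last exact: iter_laurent_smul2.
have [[a Aa] lA] := iA; have [[b Fb] lF] := iF.
have oA : order_ge a (serK2 A).
  move=> m ma; apply: laurent_ext => j.
  by rewrite coef_serK2// Aa// raddf0.
have oF : order_ge b (serW2 F).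
  move=> m ma; apply: laurent_ext => j.
  by rewrite coef_serW2// Fb// raddf0.
rewrite coeflM (coefl_isum _ (isupp_conv n oA oF)).
rewrite -[smul2 A F n]/(isum _) (isum_eval _ (isupp_smul2 (n := n) Aa Fb)).
rewrite [LHS](@isum_morph _ _ (@sqW K W) a (n - b + 1)).
- apply: eq_isum => i; rewrite serK2E// serW2E// -serW_smul// coef_serW//.
  exact: is_laurent_smul.
- exact: raddf0.
- exact: raddfD.
- by move=> i ai; rewrite (isupp_smul2 (n := n) Aa Fb).
Qed.

Lemma iter_laurent_pD p F : is_laurent p -> iter_laurent F -> iter_laurent (pD p F).
Proof.
move=> lp [oF lF]; split; first exact: is_laurent_pD.
move=> n; have [[a pa] [b Fb]] := (lp, is_laurent_fderiv oF).
apply: is_laurent_isum (isupp_smul n pa Fb) _ => i.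
have [c Fc] := lF (n - i + 1); exists c => k kc.
by rewrite -[LHS]/(p i *: (_ *: F (n - i + 1) k)) Fc// !scaler0.
Qed.

Lemma serW2_pD p F : is_laurent p -> iter_laurent F ->
  serW2 (pD p F) = pder1 (serK p) (serW2 F).
Proof.
move=> lp iF; apply: laurent_ext => n; apply: laurent_ext => k.
rewrite coef_serW2; last exact: iter_laurent_pD.
rewrite /pder1 /scale_der /= coef_lift1M.
have [oF lF] := iF; have [[a pa] [b Fb]] := (lp, is_laurent_fderiv oF).
rewrite -[pD p F n]/(isum _) (isum_eval _ (isupp_smul n pa Fb)).
rewrite [LHS](@isum_morph _ _ (@sqW K W) a (n - b + 1)).
- apply: eq_isum => i; rewrite -[X in sqW X]/(p i *: ((n - i + 1)%:~R *: F (n - i + 1) k)).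
  rewrite -!sqKW sqK_int coef_serK// coef_deriv !mulrzl coeflMz coef_serW2//.
- exact: raddf0.
- exact: raddfD.
- by move=> i ai; have /(congr1 (fun g : int -> W => g k)) := isupp_smul n pa Fb i ai.
Qed.

Lemma iter_laurent_iter_pD p F j : is_laurent p -> iter_laurent F ->
  iter_laurent (iter j (pD p) F).
Proof. by move=> lp iF; elim: j => //= j; exact: iter_laurent_pD. Qed.

Lemma sqK_invfact j : sqK W (j`!%:R^-1) = (j`!%:R)^-1.
Proof.
rewrite rmorphV ?rmorph_nat// unitfE.
by case: j`! (fact_gt0 j).
Qed.

Lemma serW2_pDdiv p F j a b : is_laurent p -> iter_laurent F ->
  sqW (pDdiv p j F a b) = divpow (pder1 (serK p)) j (serW2 F) a b.
Proof.
move=> lp iF; rewrite /divpow (invfact_lconst QS) !coef_lconstM -sqK_invfact.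
have <- : serW2 (iter j (pD p) F) = iter j (pder1 (serK p)) (serW2 F).
  by elim: j => //= j <-; rewrite serW2_pD//; exact: iter_laurent_iter_pD.
by rewrite coef_serW2 ?sqKW//; exact: iter_laurent_iter_pD.
Qed.

Lemma is_laurent2_iter F : is_laurent2 F -> iter_laurent F.
Proof.
move=> [N FN]; split=> [|m].
  by exists N => m mN; apply/funext => n; apply: FN; rewrite mN.
by exists N => n nN; apply: FN; rewrite nN orbT.
Qed.

Lemma bounded2_serW2 F : is_laurent2 F -> bounded2 (serW2 F).
Proof.
move=> lF; have iF := is_laurent2_iter lF; have [N FN] := lF; exists N; split.
  by move=> m mN; apply: laurent_ext => n; rewrite coef_serW2// FN ?mN// raddf0.
by move=> m n nN; rewrite coef_serW2// FN ?nN ?orbT// raddf0.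
Qed.

Lemma serW2_subst_phi p F m n : is_laurent p -> is_laurent2 F ->
  sqW (subst_phi p F m n) = tau (serK p) (serW2 F) m n.
Proof.
move=> lp lF; have iF := is_laurent2_iter lF; have bF := bounded2_serW2 lF.
case: m => j; last first.
  rewrite order_ge_tau// coefl0 /subst_phi /diag -[X in sqW X]/(isum _).
  by rewrite isum0 ?raddf0.
have bj := bounded2_divpow1 (serK p) QS j bF; have [N bN] := bj.
rewrite coef_tau coef_diagl// /subst_phi /diag -[X in sqW X]/(isum _).
rewrite (@isum_morph _ _ (@sqW K W) N (n - N + 1)).
- by apply: eq_isum => a; exact: serW2_pDdiv.
- exact: raddf0.
- exact: raddfD.
- move=> a aN; apply: (@sqW_inj K W); rewrite raddf0.
  by rewrite [LHS]serW2_pDdiv// (isupp_diag bN).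
Qed.

End Embedding.

(** * Skew-symmetry of a vertex algebra *)

Section Linear.
Variables (K : fieldType) (U V : lmodType K) (f : U -> V).
Hypothesis lf : linear f.

Lemma linear_add0 : f 0 = 0.
Proof. by have := lf (-1) 0 0; rewrite scaler0 addr0 scaleN1r addNr. Qed.

Lemma linear_addD : {morph f : u v / u + v}.
Proof. by move=> u v; rewrite -[u in LHS]scale1r lf scale1r. Qed.

Lemma linear_sub u v : f (u - v) = f u - f v.
Proof. by rewrite -scaleN1r addrC lf scaleN1r addrC. Qed.

Lemma linear_mulz u n : f (u *~ n) = f u *~ n.
Proof.
have H k : f (u *+ k) = f u *+ k.
  by elim: k => [|k IHk]; rewrite ?mulr0n ?linear_add0// !mulrS linear_addD IHk.
case: n => n; first exact: H.
by rewrite NegzE !mulrNz -sub0r linear_sub linear_add0 sub0r -!pmulrn H.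
Qed.

End Linear.

Section SkewSymmetry.
Variables (K : fieldType) (V : lmodType K) (Y : V -> V -> int -> V) (vac : V).
Hypotheses (K0 : forall n, n.+1%:R != 0 :> K) (hV : is_vertex_algebra Y vac).

Lemma gbinom_m1 i : gbinom K (-1) i = (-1) ^+ i.
Proof.
rewrite /gbinom; apply: (canLR (mulfK _)).
  by case: i`! (fact_gt0 i).
elim: i => [|i IHi]; first by rewrite big_geq// fact0 expr0 mulr1.
rewrite big_nat_recr//= IHi factS natrM exprS.
have -> : (-1 - i%:Z)%:~R = - i.+1%:R :> K.
  by rewrite -opprD mulrNz -[1 + i%:Z]/(i.+1%:Z).
by ring.
Qed.

Lemma gbinom_0 l : gbinom K l 0 = 1.
Proof. by rewrite /gbinom big_geq// fact0 divr1. Qed.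

Lemma Y0l v n : Y 0 v n = 0.
Proof. exact: (linear_add0 (va_linear_l hV v n)). Qed.

Lemma Y0r v n : Y v 0 n = 0.
Proof. exact: (linear_add0 (va_linear_r hV v n)). Qed.

Lemma sign_absz (n : int) : (-1 : K) ^ n = (-1) ^+ `|n|.
Proof.
case: n => n; first by [].
by rewrite -[LHS]/(((-1) ^+ n.+1)^-1) -exprVn invrN1.
Qed.

Lemma isupp_skew a u v n : order_ge a (Y u v) ->
  isupp a (n + 1) (fun j => Y (Y u v j) vac (n - j) *~ (-1) ^+ `|j|).
Proof.
move=> Ya j ja; have [?|?] := ltP j a; first by rewrite Ya// Y0l mul0rz.
by rewrite (proj2 (va_creation hV _))// ?mul0rz//; lia.
Qed.

(** Y(v, z) u = e^{zT} Y(u, -z) v, where T^i x / i! is the coefficient of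
    Y(x, z) vac at z^i. This is the Borcherds identity for u, v and vac with
    m = -1 and n = 0: creation leaves a single term on its right-hand side. *)
Lemma skew_symmetry u v n :
  Y v u n = isum (fun j => Y (Y u v j) vac (n - j) *~ (-1) ^+ `|j|).
Proof.
have [a Ya] := va_truncation hV u v.
have := va_jacobi hV u v vac (- n - 1) (-1) 0.
rewrite [RHS](@fsum_seq _ _ [:: 0%N])//; last first.
  move=> i; rewrite inE -lt0n => i0; rewrite /mode.
  rewrite (proj2 (va_creation hV v)); last by lia.
  rewrite Y0r (proj2 (va_creation hV u)); last by lia.
  by rewrite Y0r scaler0 subr0 scaler0.
rewrite big_seq1 gbinom_0 /mode (proj2 (va_creation hV v)); last by lia.
rewrite Y0r expr0 mulr1 scale1r sub0r.
rewrite (_ : - (-1 + 0) - 1 = 0); last by lia.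
rewrite (proj1 (va_creation hV u)) (_ : - (0 + (- n - 1) - 0%:Z) - 1 = n); last by lia.
rewrite (@fsum_seq _ _ (iota 0 `|(n + 1 - a)%R|)) ?iota_uniq//; last first.
  move=> i; rewrite mem_iota => ia; rewrite Ya ?Y0l ?scaler0//; lia.
rewrite (@isum_seq _ [seq n - i%:Z | i <- iota 0 `|(n + 1 - a)%R|]); first last.
- move=> j /mapP jn; apply: (isupp_skew Ya); apply/negP => ja; case: jn.
  by exists `|(n - j)%R|%N; [rewrite mem_iota|]; lia.
- by rewrite map_inj_uniq ?iota_uniq// => i j; lia.
move=> /eqP; rewrite -eqr_oppLR => /eqP.
move=> /(congr1 ( *:%R ((-1) ^ (- n - 1)))).
rewrite scalerA sign_absz -expr2 sqrr_sign scale1r => <-.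
rewrite big_map scalerN scaler_sumr -sumrN; apply: eq_bigr => i _.
rewrite (_ : - (- n - 1 + i%:Z) - 1 = n - i%:Z); last by lia.
rewrite (_ : - (-1 + 0 - i%:Z) - 1 = n - (n - i%:Z)); last by lia.
rewrite gbinom_m1 scalerA -scaleNr -scaler_int; congr (_ *: _).
rewrite rmorphXn /= rmorphN1 -mulN1r mulrA -exprS -exprD.
have E : odd (`|(- n - 1)%R|.+1 + i) = odd `|(n - i%:Z)%R| by lia.
by rewrite -signr_odd E signr_odd.
Qed.

End SkewSymmetry.

(** * phi-coordinated modules *)

Section PhiModule.
Variables (K : fieldType) (V : lmodType K) (Y : V -> V -> int -> V) (vac : V).
Hypotheses (K0 : forall n, n.+1%:R != 0 :> K) (hV : is_vertex_algebra Y vac).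
Variables (p : int -> K) (lp : is_laurent p) (p0 : p <> (fun=> 0)).
Variables (W : lmodType K) (YW : V -> W -> int -> W).
Hypothesis hW : is_phi_module Y vac p YW.

Local Notation S := (sqz W).
Let QS : qalg S := sqz_qalg W K0.
Let QL : qalg (laurent S) := qalg_laurent QS.
Let P : laurent S := serK W p.
Local Notation y := (phi_shift P).

(** Over a field the lowest coefficient of a nonzero series is invertible. *)
Lemma valuation_exists : exists r, order_ge r P /\ P r \is a GRing.unit.
Proof.
have [N pN] := lp.
have [n0 pn0] : exists n, p n != 0.
  by apply/not_existsP => p0'; apply: p0; apply/funext => n; apply/eqP/negPn/negP/p0'.
have exk : exists k : nat, p (N + k%:Z) != 0.
  exists `|(n0 - N)%R|%N; have [?|?] := ltP n0 N; first by rewrite pN ?eqxx in pn0.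
  by rewrite (_ : N + _ = n0)//; lia.
case: (ex_minnP exk) => k pk kmin; exists (N + k%:Z); split; last first.
  by rewrite coef_serK// sqK_unit.
move=> n nk; rewrite coef_serK//; have [->|pn] := eqVneq (p n) 0; first exact: raddf0.
have [?|?] := ltP n N; first by rewrite pN// raddf0.
have := kmin `|(n - N)%R|%N; rewrite (_ : N + _ = n); last by lia.
by move=> /(_ pn); lia.
Qed.

Lemma P_unit : P \is a GRing.unit.
Proof. by have [r [Pr Pu]] := valuation_exists; have [] := low_unit Pr Pu. Qed.

Lemma YW0l w : YW 0 w = 0.
Proof. by apply/funext => n; exact: (linear_add0 (pm_linear_l hW w n)). Qed.

Lemma YW0r v n : YW v 0 n = 0.
Proof. exact: (linear_add0 (pm_linear_r hW v n)). Qed.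

(** Y_W(Y(u, z0) v, x) w, with z0 as the first index. *)
Definition product_series u v w : int -> int -> W := fun m => YW (Y u v m) w.

Lemma iter_laurent_product_series u v w : iter_laurent (product_series u v w).
Proof.
split=> [|m]; last exact: (pm_truncation hW).
by have [a Ya] := va_truncation hV u v; exists a => m ma; rewrite /product_series Ya// YW0l.
Qed.

Lemma prod_below2 u v w : exists N, below2 N (prod_z1z2 YW u v w).
Proof.
have [N YN] := pm_truncation hW v w; exists N => a b bN.
by rewrite /prod_z1z2 YN// YW0r.
Qed.

Lemma is_laurent2_zdiff (M : zmodType) k (F : int -> int -> M) :
  is_laurent2 F -> is_laurent2 (iter k (@zdiff M) F).
Proof.
move=> [N FN]; exists N => a b ab.
by elim: k a b ab => //= k IHk a b ab; rewrite /zdiff !IHk ?subrr//; lia.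
Qed.

Lemma iter_zdiff_morph (M N : zmodType) (h : {additive M -> N}) k (F : int -> int -> M) a b :
  h (iter k (@zdiff M) F a b) = iter k (@zdiff N) (fun a b => h (F a b)) a b.
Proof. by elim: k a b => //= k IHk a b; rewrite /zdiff raddfB !IHk. Qed.

Lemma serW2_iter_zdiff k F : is_laurent2 F ->
  serW2 (iter k (@zdiff W) F) = z12 S ^+ k * serW2 F.
Proof.
move=> lF; elim: k => [|k IHk]; first by rewrite expr0 mul1r.
rewrite exprS -mulrA -IHk; apply: laurent_ext => a; apply: laurent_ext => b.
have lk j := is_laurent2_iter (is_laurent2_zdiff j lF).
by rewrite (coef_serW2 (lk k.+1)) coef_z12M /zdiff !(coef_serW2 (lk k)) -raddfB.
Qed.

Lemma tau_z12XM k A : bounded2 A -> tau P (z12 S ^+ k * A) = y ^+ k * tau P A.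
Proof.
move=> bA; elim: k => [|k IHk]; first by rewrite !expr0 !mul1r.
rewrite !exprS -!mulrA -IHk (tau_z12M P QS)//.
elim: k {IHk} => [|k IHk]; first by rewrite mul1r.
by rewrite exprS -mulrA; apply: bounded2M => //; exact: bounded2_z12.
Qed.

(** The module axiom in ring form, for all large exponents: multiplying by a
    further z1 - z2 multiplies the image by phi - x. *)
Lemma associativity u v : exists k0, forall k, (k0 <= k)%N -> forall w,
  let A := iter k (@zdiff W) (prod_z1z2 YW u v w) in
  is_laurent2 A /\ y ^+ k * serW2 (product_series u v w) = tau P (serW2 A).
Proof.
have [k0 [lA EA]] := pm_assoc hW u v; exists k0 => k k0k w.
rewrite /= -(subnK k0k) iterD.
have lw := lA w; split; first exact: is_laurent2_zdiff.
rewrite (serW2_iter_zdiff _ lw) tau_z12XM; last exact: bounded2_serW2.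
rewrite exprD -mulrA; congr (_ * _).
have iE := iter_laurent_product_series u v w.
have iphi := iter_laurent_phi_sub lp.
have [ik Ek] : iter_laurent (iter k0 (smul2 (phi_sub p)) (product_series u v w)) /\
    serW2 (iter k0 (smul2 (phi_sub p)) (product_series u v w)) =
    y ^+ k0 * serW2 (product_series u v w).
  elim: k0 {lA EA k0k lw} => [|k0 [ik Ek]] /=; first by rewrite mul1r.
  split; first exact: iter_laurent_smul2.
  by rewrite serW2_smul2// Ek (serK2_phi_sub W K0 lp) mulrA exprS.
rewrite -Ek; apply: laurent_ext => m; apply: laurent_ext => n.
by rewrite coef_serW2// -(serW2_subst_phi K0 _ _ lp lw) EA.
Qed.

(** Y_W(Y(u, z0) vac, x) = Y_W(u, phi(x, z0)): the module axiom for the pair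
    u, vac, with the invertible factor (phi - x)^k cancelled. It says that
    Y_W(T^n u / n!, x) = D^n Y_W(u, x) / n!. *)
Lemma product_series_vacuum u w : serW2 (product_series u vac w) = expd (pder P) (serW (YW u w)).
Proof.
have [k H] := associativity u vac; have [_ EA] := H k (leqnn k) w.
have [yu _] := phi_shift_unit QS P_unit.
apply: (mulrI (unitrX k yu)); rewrite EA.
set F := prod_z1z2 YW u vac w.
have FE a b : F a b = if b == 0 then YW u w a else 0.
  by rewrite /F /prod_z1z2 (pm_vacuum hW) /const_series; case: ifP; rewrite ?YW0r.
have [N YN] := pm_truncation hW u w.
have lF : is_laurent2 F.
  exists (Num.min N 0) => a b ab; rewrite FE; case: eqP => // b0.
  by rewrite YN//; lia.
rewrite (serW2_iter_zdiff _ lF) (tau_z12XM _ (bounded2_serW2 lF)); congr (_ * _).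
have -> : serW2 F = lift1 (serW (YW u w)) * 1.
  rewrite mulr1; apply: laurent_ext => a; apply: laurent_ext => b.
  rewrite (coef_serW2 (is_laurent2_iter lF)) coef_lift1 FE coef_serW//; last by exists N.
  by case: ifP => // _; rewrite raddf0.
have b1 : bounded2 (1 : laurent (laurent S)) by exact: (bounded2_lconst 1).
have t1 : tau P 1 = 1 by exact: (tau_lconst P QS 1).
by rewrite (tau_lift1M P QS _ b1) t1 mulr1.
Qed.

(** Skew-symmetry of the algebra, transported to W by the previous lemma: the
    translation e^{z0 T} becomes e^{z0 D}. *)
Lemma product_series_skew u v w :
  serW2 (product_series u v w) = expdL (pder P) (sgnl (serW2 (product_series v u w))).
Proof.
have iE := iter_laurent_product_series.
apply: laurent_ext => n; rewrite coef_expdL; apply: laurent_ext => k.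
have [a Ya] := va_truncation hV v u.
have FN : order_ge a (sgnl (serW2 (product_series v u w))).
  apply: order_ge_sgnl => m ma; apply: laurent_ext => j.
  by rewrite (coef_serW2 (iE _ _ _)) /product_series Ya// YW0l raddf0.
rewrite (coefl_isum _ (@isupp_expdL _ (pder P) _ _ n FN)).
rewrite (coef_serW2 (iE _ _ _)) /product_series (skew_symmetry K0 hV v u n).
rewrite (@isum_morph _ _ (fun x => sqW (YW x w k)) a (n + 1)).
- apply: eq_isum => j; rewrite coef_sgnl (raddfMz (expd (pder P))) /=.
  rewrite (linear_mulz (pm_linear_l hW w k)) raddfMz.
  rewrite (serW2E _ (iE _ _ _)) /product_series -product_series_vacuum.
  by rewrite !coeflMz (coef_serW2 (iE _ _ _)).
- by rewrite YW0l raddf0.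
- by move=> x x'; rewrite (linear_addD (pm_linear_l hW w k)) raddfD.
- by have := isupp_skew hV (n := n) Ya.
Qed.

(** By weak commutativity the two products of fields are expansions of one and
    the same (z1 - z2)^{-k} A, so that [diff_residue] applies: the right-hand
    side is Res_{z0} Y_W(Y(u, z0) v, x) w phi^{-a-1} (d phi / d z0). *)
Lemma commutator_residue u v w a b :
  sqW (commutator YW u v w a b) =
    (serW2 (product_series u v w) *
      (expd (pder P) (mono (- a - 1) 1) * expd (pder P) P)) (- 1) b.
Proof.
have [k1 H1] := associativity u v; have [k2 H2] := associativity v u.
pose k := (k1 + k2)%N.
have [lA EA] := H1 k (leq_addr _ _) w; have [lB EB] := H2 k (leq_addl _ _) w.
set A := iter k _ _ in lA EA; set B := iter k _ _ in lB EB.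
pose Bt a b := B b a.
have lBt : is_laurent2 Bt.
  by have [N BN] := lB; exists N => c d cd; apply: BN; rewrite orbC.
have bBt := bounded2_serW2 lBt.
have Bs : swapped (serW2 Bt) (serW2 B).
  by move=> c d; rewrite (coef_serW2 (is_laurent2_iter lBt)) (coef_serW2 (is_laurent2_iter lB)).
have AB := weak_commutativity QS P_unit (bounded2_serW2 lA) (bounded2_serW2 lB)
  bBt Bs EA EB (product_series_skew u v w).
have [N1 N1P] := prod_below2 u v w; have [N2 N2P] := prod_below2 v u w.
have [N [NN1 NN2]] : exists N, N <= N1 /\ N <= N2.
  by exists (- (`|N1| + `|N2|)%N%:Z); lia.
pose f a b := sqW (prod_z1z2 YW u v w a b).
pose g a b := sqW (prod_z1z2 YW v u w b a).
have fN : below2 N f by move=> c d dN; rewrite /f N1P ?raddf0//; lia.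
have gN : below1 N g by move=> c d dN; rewrite /g N2P ?raddf0//; lia.
have iA := is_laurent2_iter lA; have iB := is_laurent2_iter lB.
have fA : iter k (@zdiff S) f =2 (fun a b => serW2 A a b).
  by move=> c d; rewrite (coef_serW2 iA) /A iter_zdiff_morph.
have gA : iter k (@zdiff S) g =2 (fun a b => serW2 A a b).
  move=> c d; rewrite AB -signr_odd mulr_sign.
  have -> : iter k (@zdiff S) g c d = (-1) ^+ odd k * serW2 Bt c d.
    rewrite (coef_serW2 (is_laurent2_iter lBt)) /Bt /B iter_zdiff_morph signr_odd.
    elim: k {lA EA lB EB A B Bt lBt bBt Bs AB fA iA iB} c d => [|k IHk] c d.
      by rewrite mul1r.
    by rewrite /= /zdiff !IHk exprS mulN1r !mulNr -mulrN opprB mulrBr.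
  rewrite mulr_sign; case: odd => //.
rewrite /commutator raddfB.
exact: (diff_residue QS P_unit fN gN (bounded2_serW2 lA) fA gA EA).
Qed.

(** phi^{-a-1} p(phi) = e^{z0 D}(p(x) x^{-a-1}), so the residue pairs the
    coefficient Y_W(u_j v, x) at z0^{-j-1} with D^j / j!. *)
Lemma commutator_formula_modes u v :
  commutator_formula p YW u v (fun j : nat => mode Y u j%:Z v).
Proof.
move=> w a N; have [c Yc] := va_truncation hV u v.
(* u_j v is the coefficient of Y(u, z) v at z^{-j-1}, which is zero once
   -j-1 lies below the order c; from then on the partial sums are constant. *)
exists `|c|%N => J cJ n _; apply: (@sqW_inj K W).
rewrite commutator_residue -(expdM QL (@pderM S P)) [mono _ _ * P]mulrC.
have iE := iter_laurent_product_series u v w.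
have Ec : order_ge c (serW2 (product_series u v w)).
  move=> m mc; apply: laurent_ext => j.
  by rewrite (coef_serW2 iE) /product_series Yc// YW0l raddf0.
set T := P * mono _ 1.
rewrite coeflM (coefl_isum _ (isupp_conv _ Ec (order_ge_expd (pder P) T))).
rewrite (@isum_seq _ [seq - j%:Z - 1 | j <- iota 0 J]); first last.
- move=> i iJ; have [i0|i0] := ltP i 0; last by rewrite order_ge_expd ?mulr0//; lia.
  have [ic|ic] := ltP i c; first by rewrite Ec// mul0r.
  case/negP: iJ; apply/mapP; exists `|(- i - 1)%R|%N; last by lia.
  by rewrite mem_iota; lia.
- by rewrite map_inj_uniq ?iota_uniq// => i j; lia.
rewrite big_map raddf_sum /index_iota subn0; apply: eq_bigr => j _.
have lY := pm_truncation hW (mode Y u j%:Z v) w.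
have lc : is_laurent (comm_term p YW (mode Y u j%:Z v) j w a).
  apply: is_laurent_smul => //; apply: (@is_laurent_pDdiv K K^o) => //.
  exact: is_laurent_pbar_delta.
rewrite -[LHS]/(sqW (comm_term p YW (mode Y u j%:Z v) j w a n)).
rewrite -(coef_serW lc) (serW_comm_term K0 _ _ lp lY) -/P -/T.
rewrite (_ : -1 - (- j%:Z - 1) = j%:Z); last by lia.
by rewrite coef_expd (serW2E _ iE) mulrC.
Qed.

(** The difference of two formulas is an infinite-order operator that kills
    p(x) x^m for every m. *)
Lemma formula_coefficients_unique u v (c : nat -> V) :
  is_faithful YW -> commutator_formula p YW u v c ->
  forall j, c j = mode Y u j%:Z v.
Proof.
move=> fY hc j; apply/eqP; rewrite -subr_eq0; apply/eqP.
have [r [Pr Pru]] := valuation_exists.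
pose d i := c i - mode Y u i%:Z v.
suff YWd w : serW (YW (d j) w) = 0.
  apply: fY; apply/funext => w; rewrite YW0l; apply/funext => n.
  apply: (@sqW_inj K W); rewrite -[YW _ w n]/(YW (d j) w n).
  by rewrite -(coef_serW (pm_truncation hW (d j) w)) YWd raddf0.
apply: (formal_operator_unique QS Pr Pru (f := fun j => serW (YW (d j) w))).
move=> m N; have [J1 H1] := hc w (- m - 1) N.
have [J2 H2] := commutator_formula_modes u v w (- m - 1) N.
exists (maxn J1 J2) => J; rewrite geq_max => /andP [J1J J2J] n nN.
have := H1 J J1J n nN; rewrite -(H2 J J2J n nN) => /(congr1 (@sqW K W)).
rewrite !raddf_sum /= => /eqP; rewrite -subr_eq0 -sumrB => /eqP E; rewrite -[RHS]E.
apply: eq_bigr => i _.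
have lY x := pm_truncation hW x w.
have lc x : is_laurent (comm_term p YW x i w (- m - 1)).
  apply: is_laurent_smul => //; apply: (@is_laurent_pDdiv K K^o) => //.
  exact: is_laurent_pbar_delta.
rewrite -!(coef_serW (lc _)) !(serW_comm_term K0 _ _ lp (lY _)) -/P.
rewrite (_ : - (- m - 1) - 1 = m); last by lia.
rewrite -coeflB -mulrBr mulrC; congr (lcoef (_ * _) n).
apply: laurent_ext => l; rewrite coeflB !coef_serW// /d.
by rewrite (linear_sub (pm_linear_l hW w l)) raddfB.
Qed.

End PhiModule.

Theorem proposition3p5 (R : realType)
  (V : lmodType R[i]) (Y : V -> V -> int -> V) (vac : V)
  (hV : is_vertex_algebra Y vac)
  (p : int -> R[i]) (hp : is_laurent p) (hp0 : p <> (fun=> 0))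
  (W : lmodType R[i]) (YW : V -> W -> int -> W)
  (hW : is_phi_module Y vac p YW) :
  (forall u v : V,
     commutator_formula p YW u v (fun j : nat => mode Y u j%:Z v)) /\
  (is_faithful YW ->
   forall (u v : V) (c : nat -> V),
     commutator_formula p YW u v c ->
     forall j : nat, c j = mode Y u j%:Z v).
Proof.
have K0 n : n.+1%:R != 0 :> R[i] by rewrite pnatr_eq0.
split=> [u v|faithful u v c hc].
  exact: (commutator_formula_modes K0 hV hp hp0 hW u v).
exact: (formula_coefficients_unique K0 hV hp hp0 hW faithful hc).
Qed.
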